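(* Let $n\in\mathbb{N}^+$ and let $K$ be a compact metric space with $\dim_t K\geq n$. Then for the generic $f\in C_n(K)$, $$\sup_{y\in\mathbb{R}^n}\dim_H f^{-1}(y)=\dim_{t^nH}K-n.$$
   Context: $\mathbb{N}=\{0,1,2,\dots\}$ and $\mathbb{N}^+=\{1,2,\dots\}$. $\dim_H$ is Hausdorff dimension, with the convention $\dim_H\emptyset=-1$. $\dim_t$ is the small inductive topological dimension: $\dim_t\emptyset=-1$ and, for a non-empty metric space $X$, $\dim_t X=\inf\{d: X \text{ has a basis } \mathcal{U} \text{ such that } \dim_t\partial U\leq d-1 \text{ for every } U\in\mathcal{U}\}$. The $n$th inductive topological Hausdorff dimension is defined by $\dim_{t^nH}\emptyset=-1$ for all $n\in\mathbb{N}$, and for non-empty $X$ by $\dim_{t^0H}X=\dim_H X$ and, for $n\geq 1$, $\dim_{t^nH}X=\inf\{d: X\text{ has a basis }\mathcal{U}\text{ such that }\dim_{t^{n-1}H}\partial U\leq d-1\text{ for every }U\in\mathcal{U}\}$. All these dimensions may take the value $\infty$ (so $d=\infty$ is allowed in the infima), with $\infty-c=\infty$ for finite $c$. $C_n(K)$ is the complete metric space of continuous functions $K\to\mathbb{R}^n$ with the supremum norm. A property holds for the generic element of a complete metric space if the set of elements having it is co-meager. *)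

(* Defs.v *)
From HB Require Import structures.
From mathcomp Require Import all_boot all_order all_algebra.
From mathcomp Require Import all_classical all_reals all_analysis.

Set Implicit Arguments.
Unset Strict Implicit.
Unset Printing Implicit Defensive.

Import Order.TTheory GRing.Theory Num.Theory.
Import numFieldNormedType.Exports.

Local Open Scope classical_set_scope.
Local Open Scope ring_scope.
Local Open Scope ereal_scope.

Section Baire_category.
Context {X : topologicalType}.

Definition boundary (U : set X) : set X := closure U `\` interior U.

Definition nowhere_dense (A : set X) : Prop := interior (closure A) = set0.

Definition meager (A : set X) : Prop :=
  exists2 F : nat -> set X,
    (forall i, nowhere_dense (F i)) & A = \bigcup_i F i.

Definition comeager (A : set X) : Prop := meager (~` A).

End Baire_category.

(* All dimensions below are those of a subset [A] of a metric space [T],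
   regarded as a metric space with the induced metric; the dimension of [T]
   itself is obtained for [A := setT]. *)
Section dimensions.
Context {R : realType} {T : metricType R}.
Implicit Types A : set T.

Definition diam A : \bar R :=
  maxe 0 (ereal_sup [set (mdist p.1 p.2)%:E | p in A `*` A]).

(* Since [0 `^ 0 = 1], the case split makes the empty set contribute 0 also for
   [s = 0]. *)
Definition diam_pow (s : R) (U : set T) : \bar R :=
  if U == set0 then 0 else diam U `^ s.

Definition hausdorff_premeasure (s delta : R) A : \bar R :=
  ereal_inf [set \sum_(0 <= i <oo) diam_pow s (F i) | F in
    [set F : nat -> set T |
       A `<=` \bigcup_i F i /\ forall i, diam (F i) <= delta%:E]].

Definition hausdorff_measure (s : R) A : \bar R :=
  ereal_sup [set hausdorff_premeasure s delta A | delta in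
    [set delta : R | (0 < delta)%R]].

Definition dimH A : \bar R :=
  if A == set0 then - 1%E
  else ereal_inf [set s%:E | s in
    [set s : R | (0 <= s)%R /\ hausdorff_measure s A = 0]].

(* [B] is a basis of the space [A], and the boundary of [U] is relative to [A];
   it is then seen as a subset of [T]. *)
Definition basis_with_boundaries (P : set T -> Prop) A : Prop :=
  exists2 B : set (set A), basis B &
    forall U, B U -> P (set_val @` boundary U).

Definition inductive_step (D : set T -> \bar R) A : \bar R :=
  ereal_inf [set d : \bar R |
    basis_with_boundaries (fun V => D V <= d - 1) A].

Fixpoint dim_tH (n : nat) A : \bar R :=
  match n with
  | 0 => dimH A
  | m.+1 => if A == set0 then - 1%E else inductive_step (dim_tH m) A
  end.

(* [dim_t_lt k A] says that the small inductive dimension of [A] is at most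
   [k - 1]. The recursive equation satisfied by [dim_t] is [dim_tE] below. *)
Fixpoint dim_t_lt (k : nat) A : Prop :=
  match k with
  | 0 => A = set0
  | m.+1 => basis_with_boundaries (dim_t_lt m) A
  end.

Definition dim_t A : \bar R :=
  ereal_inf [set (k%:R - 1)%:E | k in [set k : nat | dim_t_lt k A]].

Lemma basis_with_boundaries_sub (P Q : set T -> Prop) A :
  (forall V, P V -> Q V) ->
  basis_with_boundaries P A -> basis_with_boundaries Q A.
Proof. by move=> PQ [B bB BP]; exists B => // U /BP /PQ. Qed.

Lemma set0_basis_with_boundaries (P : set T -> Prop) :
  basis_with_boundaries P set0.
Proof.
exists set0 => //; split => //.
by case=> x x0; have := set_mem x0.
Qed.

Lemma dim_t_ltS k A : dim_t_lt k A -> dim_t_lt k.+1 A.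
Proof.
elim: k A => [A ->|k IH A]; first exact: set0_basis_with_boundaries.
exact: basis_with_boundaries_sub.
Qed.

Lemma dim_t_lt_le k l A : (k <= l)%N -> dim_t_lt k A -> dim_t_lt l A.
Proof.
move=> /subnKC <-; elim: (l - k)%N => [|j IH]; first by rewrite addn0.
by rewrite addnS => /IH /dim_t_ltS.
Qed.

Lemma not_dim_t_lt k A : ~ dim_t_lt k A -> k%:R%:E <= dim_t A.
Proof.
move=> nkA; apply: le_ereal_inf_tmp => _ [l lA <-]; rewrite lee_fin.
rewrite lerBrDr natr1 ler_nat ltnNge; apply/negP => lk.
exact/nkA/(dim_t_lt_le lk).
Qed.

Lemma dim_t_le k A : dim_t A <= (k%:R - 1)%:E <-> dim_t_lt k A.
Proof.
split=> [dk|kA]; last by apply: ereal_inf_lbound; exists k.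
apply: contrapT => /not_dim_t_lt /le_trans /(_ dk).
by rewrite lee_fin lerBrDl gerDr ler10.
Qed.

Lemma dim_t_geN1 A : - 1%E <= dim_t A.
Proof.
by apply: le_ereal_inf_tmp => _ [k _ <-]; rewrite lee_fin lerBrDr addNr.
Qed.

Lemma dim_tE A : dim_t A =
  if A == set0 then - 1%E else inductive_step dim_t A.
Proof.
case: eqP => [->|/eqP/set0P A0]; apply/eqP; rewrite eq_le.
  rewrite dim_t_geN1 andbT; apply: ereal_inf_lbound.
  by exists 0%N => //=; rewrite sub0r.
case: (A0) => x Ax; apply/andP; split; apply: le_ereal_inf_tmp.
  move=> d [B [Bo Bb] Bd].
  have d0 : - 1%E <= d - 1.
    have [U [BU _] _] := Bb (exist _ x (mem_set Ax)) setT filterT.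
    exact: le_trans (dim_t_geN1 _) (Bd U BU).
  case: d Bd d0 => [r Bd r0| _ _|//]; last by rewrite leey.
  move: r0; rewrite lee_fin lerBrDr addNr => r0.
  apply: (@le_trans _ _ ((Num.truncn r).+1%:R - 1)%:E); last first.
    by rewrite lee_fin -natr1 addrK truncn_le.
  apply/dim_t_le; exists B => // U BU; apply: contrapT => /not_dim_t_lt.
  move=> /le_trans /(_ (Bd U BU)).
  rewrite lee_fin lerBrDr natr1 leNgt.
  by rewrite truncnS_gt.
move=> _ [[|k] /= kA <-]; first by move: Ax; rewrite kA.
have [B bB Bk] := kA.
apply: ereal_inf_lbound; exists B => // U BU.
by rewrite -natr1 addrK; apply/dim_t_le/Bk.
Qed.

End dimensions.

Section Cn.
Import ArrowAsUniformType.

(* The topology of [continuousType K 'rV_n] below is the one induced by the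
   supremum norm; the norm of ['rV_n] is the maximum norm, which is equivalent
   to the Euclidean one. *)
Lemma nbhs_continuousType (R : realType) (K : metricType R) (n : nat)
    (f : continuousType K 'rV[R]_n) (A : set (continuousType K 'rV[R]_n)) :
  nbhs f A <-> exists2 e : R, (0 < e)%R &
    forall g : continuousType K 'rV[R]_n,
      (forall x, (`|f x - g x| < e)%R) -> A g.
Proof.
rewrite -nbhs_entourageE; split.
- move=> [E [E1 [E2 + E21] E1E] EA].
  rewrite -entourage_ballE => -[e /= e0 eE2]; exists e => // g fg.
  apply/EA/mem_set/E1E/E21 => x /=; apply/eE2 => /=.
  by rewrite -ball_normE /=; exact: fg.
- move=> [e e0 eA].
  exists [set fg : continuousType K 'rV[R]_n * continuousType K 'rV[R]_n |
            forall x, (`|fg.1 x - fg.2 x| < e)%R]; last first.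
    by move=> g /set_mem; exact: eA.
  exists [set fg : (K -> 'rV[R]_n) * (K -> 'rV[R]_n) |
            forall x, (`|fg.1 x - fg.2 x| < e)%R] => //.
  exists [set uv : 'rV[R]_n * 'rV[R]_n | (`|uv.1 - uv.2| < e)%R] => //.
  rewrite -entourage_ballE; exists e => // -[u v] /=.
  by rewrite -ball_normE.
Qed.

End Cn.

(* Main.v *)
Require Import Defs.
From HB Require Import structures.
From mathcomp Require Import all_boot all_order all_algebra.
From mathcomp Require Import all_classical all_reals all_analysis.
From mathcomp Require Import ring lra zify.

Set Implicit Arguments.
Unset Strict Implicit.
Unset Printing Implicit Defensive.

Import Order.TTheory GRing.Theory Num.Theory.
Import numFieldNormedType.Exports.
Import ArrowAsUniformType.

Local Open Scope classical_set_scope.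
Local Open Scope ring_scope.

(* Call [C] n-coverable when, off an open set of arbitrarily small t-dimensional
   content, it splits into n families of small, uniformly separated clusters.
   If [dim_tH n K < t + n], then [K] is n-coverable: the boundaries of finitely
   many small basic open sets are (n-1)-coverable by induction, so is their
   union, and off a neighbourhood of it the basic sets cut [K] into one more
   family of clusters.  Any [f] can then be perturbed so that its j-th
   coordinate takes constant, distinct values on the clusters of the j-th
   family; a fiber then meets at most one cluster of each family, hence has
   small content, and this is stable under small perturbations.  So the generic
   [f] has all its fibers of dimension at most [t].

   Conversely, suppose that the functions whose fibers all have dimension at
   most [s < t] are dense in some ball of C_n(K).  Near any point, n pairs of
   disjoint closed sets can then be separated by partitions with a common part
   of small t-content, namely the sets [g_i = y_i] for [g] such a function.
   Building one partition as the limit of successively thinner ones, which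
   meet the requirements of a countable dense family of (n-1)-tuples of pairs
   one after the other, gives a partition on which n-1 pairs can be so
   separated; by induction [dim_tH n K <= t + n].  Hence for [s] below
   [dim_tH n K - n] these functions form a nowhere dense set. *)

(** * Finite open covers of small content *)

Section metric_compactness.
Context {R : realType} {T : metricType R}.
Implicit Types A B C U : set T.

(** Compactness as an induction principle: if [Q A] failed, the sets whose complement in [A]
    satisfies [Q] would form a proper filter, and its cluster point would contradict the local
    hypothesis. *)
Lemma compact_local_ind A (Q : set T -> Prop) :
  compact A -> Q set0 -> (forall B C, B `<=` C -> Q C -> Q B) ->
  (forall B C, Q B -> Q C -> Q (B `|` C)) ->
  (forall x, A x -> exists2 U, nbhs x U & Q (A `&` U)) -> Q A.
Proof.
move=> cA Q0 Qsub QU Qloc; apply: contrapT => nQA.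
pose F : set_system T := [set S | Q (A `\` S)].
have FF : ProperFilter F.
  split; first by rewrite /F /= setD0.
  split; rewrite /F /=.
  - by rewrite setDT.
  - move=> S S' QS QS'; apply: (Qsub _ _ _ (QU _ _ QS QS')) => x [Ax nSS'].
    by have [Sx|nSx] := pselect (S x); [right|left]; split => // S'x; exact: nSS'.
  - by move=> S S' SS'; apply: Qsub; exact: setDS.
have FA : F A by rewrite /F /= setDv.
have [x [Ax clx]] := cA F FF FA.
have [U xU QUA] := Qloc x Ax.
have FU : F (~` U) by rewrite /F /= setDE setCK.
by have [y []] := clx _ _ FU xU.
Qed.

(** A Lebesgue number argument: as [P] holds locally for all small radii, finitely many local bounds
    combine through their minimum. *)
Lemma compact_uniform A (P : R -> T -> Prop) :
  compact A ->
  (forall x, A x -> exists2 e, 0 < e &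
     forall y r, mdist x y < e -> 0 < r -> r < e -> P r y) ->
  exists2 r, 0 < r & forall x, A x -> P r x.
Proof.
move=> cA AP.
pose Q B := exists2 e, 0 < e & forall x r, B x -> 0 < r -> r < e -> P r x.
suff [e e0 eP] : Q A.
  by exists (e / 2); rewrite ?divr_gt0// => x Ax; apply: eP => //; lra.
apply: compact_local_ind => //.
- by exists 1.
- by move=> B C BC [e e0 eP]; exists e => // x r /BC; exact: eP.
- move=> B C [e e0 eP] [e' e'0 eP']; exists (Num.min e e').
    by rewrite lt_min e0.
  move=> x r BCx r0; rewrite lt_min => /andP[re re'].
  by case: BCx => [Bx|Cx]; [exact: eP|exact: eP'].
- move=> x /AP[e e0 eP]; exists (ball x e); first exact: nbhsx_ballx.
  by exists e => // y r [_]; rewrite ballEmdist /= => xy; exact: eP.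
Qed.

Lemma closed_metricP A :
  closed A <-> forall x, ~ A x -> exists2 r, 0 < r & forall y, mdist x y < r -> ~ A y.
Proof.
rewrite -openC openE; split=> [oA x nAx|H x /= /H[r r0 rA]].
  by have /nbhs_ballP[r r0 rA] := oA x nAx; exists r => // y xy; apply: rA; rewrite ballEmdist.
by apply/nbhs_ballP; exists r => // y; rewrite ballEmdist => /rA.
Qed.

Lemma open_metricP A :
  open A <-> forall x, A x -> exists2 r, 0 < r & forall y, mdist x y < r -> A y.
Proof.
rewrite openE; split=> [oA x Ax|H x /= /H[r r0 rA]].
  by have /nbhs_ballP[r r0 rA] := oA x Ax; exists r => // y xy; apply: rA; rewrite ballEmdist.
by apply/nbhs_ballP; exists r => // y; rewrite ballEmdist => /rA.
Qed.

Lemma closure_metricP A x :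
  closure A x <-> forall r, 0 < r -> exists2 y, A y & mdist x y < r.
Proof.
split=> [clAx r r0|H U /nbhs_ballP[r /= r0 rU]].
  by have [y [Ay]] := clAx _ (nbhsx_ballx x r r0); rewrite ballEmdist; exists y.
by have [y Ay xy] := H r r0; exists y; split => //; apply: rU; rewrite ballEmdist.
Qed.

Definition nbd (r : R) A : set T := [set y | exists2 x, A x & mdist x y < r].

Lemma open_nbd r A : open (nbd r A).
Proof.
apply/open_metricP => y [x Ax xy]; exists (r - mdist x y); first by rewrite subr_gt0.
move=> z yz; exists x => //; apply: le_lt_trans (metric_triangle _ y _) _; lra.
Qed.

Lemma sub_nbd r A : 0 < r -> A `<=` nbd r A.
Proof. by move=> r0 x Ax; exists x => //; rewrite mdistxx. Qed.

Lemma closure_sub_nbd r A : 0 < r -> closure A `<=` nbd r A.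
Proof.
by move=> r0 x /closure_metricP/(_ r r0)[y Ay xy]; exists y => //; rewrite metric_sym.
Qed.

Lemma nbd_diam r e A : (forall x y, A x -> A y -> mdist x y <= e) ->
  forall x y, nbd r A x -> nbd r A y -> mdist x y <= e + 2 * r.
Proof.
move=> Ae x y [x' Ax' xx'] [y' Ay' yy'].
have := Ae _ _ Ax' Ay'; have := metric_triangle x x' y.
have := metric_triangle x' y' y; rewrite (metric_sym x x'); lra.
Qed.

Lemma sub_compact A B : compact A -> closed B -> B `<=` A -> compact B.
Proof. by move=> cA cB BA; exact: subclosed_compact cB cA BA. Qed.

Lemma compact_closedT A : compact A -> closed A.
Proof. exact: compact_closed (@metric_hausdorff _ T). Qed.

Lemma compact_sub_nbd A U : compact A -> open U -> A `<=` U ->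
  exists2 r, 0 < r & nbd r A `<=` U.
Proof.
move=> cA /open_metricP oU AU.
have [r r0 rU] : exists2 r, 0 < r & forall x, A x -> forall y, mdist x y < r -> U y.
  apply: compact_uniform => // x /AU/oU[r r0 rU].
  exists (r / 2); first lra.
  move=> y e xy e0 er z yz; apply: rU.
  apply: le_lt_trans (metric_triangle _ y _) _; lra.
by exists r => // y [x Ax]; exact: rU.
Qed.

End metric_compactness.

Section small_covers.
Context {R : realType} {T : metricType R} (t : R) (t0 : 0 < t).
Implicit Types A B C U : set T.

(** Finite covers by open sets with diameter bounds [a] such that the sum of the [a ^ t] is strictly
    below [e]; the slack sits in [small_nil]. No mesh bound is imposed, since a small sum already
    forces small diameters. *)
Inductive small : R -> set T -> Prop :=
| small_nil e A : 0 < e -> A `<=` set0 -> small e A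
| small_cons a e U A B : 0 < a -> open U ->
    (forall x y, U x -> U y -> mdist x y <= a) ->
    small e B -> A `<=` U `|` B -> small (a `^ t + e) A.

Lemma small_gt0 e A : small e A -> 0 < e.
Proof. by elim=> // a e' *; rewrite ltr_wpDl// powR_ge0. Qed.

Lemma small_sub e A B : A `<=` B -> small e B -> small e A.
Proof.
move=> + sB; elim: sB A => {e B} [e B e0 B0 A AB|a e U B C a0 oU Ua sC IH BC A AB].
  by apply: small_nil => // x /AB/B0.
by apply: (small_cons a0 oU Ua sC) => x /AB/BC.
Qed.

Lemma small_le e e' A : e <= e' -> small e A -> small e' A.
Proof.
move=> + sA; elim: sA e' => {e A} [e B e0 B0 e' ee'|a e U B C a0 oU Ua sC IH BC e' ee'].
  by apply: small_nil => //; exact: lt_le_trans ee'.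
rewrite -(subrK (a `^ t) e') addrC; apply: (small_cons a0 oU Ua (IH _ _) BC).
by rewrite lerBrDl.
Qed.

Lemma smallU e1 e2 A B : small e1 A -> small e2 B -> small (e1 + e2) (A `|` B).
Proof.
move=> sA; elim: sA e2 B => {e1 A} [e A e0 A0 e2 B sB|a e U A C a0 oU Ua sC IH AC e2 B sB].
  apply: (@small_le e2); first by rewrite lerDr ltW.
  by apply: small_sub sB => x [/A0|].
rewrite -addrA; apply: (small_cons a0 oU Ua (IH _ _ sB)) => x [/AC |Bx].
- case=> [Ux|Cx]; [by left|by right; left].
- by right; right.
Qed.

Lemma small_open e A : small e A -> exists V, [/\ open V, A `<=` V & small e V].
Proof.
elim=> {e A} [e A e0 A0|a e U A B a0 oU Ua sB [V [oV BV sV]] AB].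
  by exists set0; split => //; [exact: open0|exact: small_nil].
exists (U `|` V); split; [exact: openU| |exact: (small_cons a0 oU Ua sV (fun x => id))].
by move=> x /AB[]; [left|right; exact: BV].
Qed.

Lemma small_diam a e A : 0 < a -> (forall x y, A x -> A y -> mdist x y <= a) ->
  (2 * a) `^ t < e -> small e A.
Proof.
move=> a0 Aa ae; apply: (@small_le ((2 * a) `^ t + (e - (2 * a) `^ t))); first lra.
apply: (@small_cons _ _ (nbd (a / 2) A) _ set0).
- lra.
- exact: open_nbd.
- by move=> x y xA yA; have := nbd_diam Aa xA yA; lra.
- by apply: small_nil => //; rewrite subr_gt0.
- by move=> x Ax; left; apply: sub_nbd => //; lra.
Qed.

(** The factor [n.+1], not [n], leaves positive content for the empty union. *)
Lemma small_bigU (e : R) (A : nat -> set T) n :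
  0 < e -> (forall i, (i < n)%N -> small e (A i)) ->
  small (n.+1%:R * e) (\bigcup_(i in [set i | (i < n)%N]) A i).
Proof.
move=> e0; elim: n => [_|n IH sA].
  by apply: small_nil => [|x [i //]]; rewrite mul1r.
have -> : n.+2%:R * e = n.+1%:R * e + e by rewrite -(natr1 n.+1) mulrDl mul1r.
have s1 := IH (fun i ilt => sA i (ltnW ilt)).
apply: small_sub (smallU s1 (sA n (ltnSn n))) => x [i /= + Aix].
by rewrite ltnS leq_eqVlt => /orP[/eqP <-|ilt]; [right|left; exists i].
Qed.

End small_covers.
Arguments small {R T}.

(** * Finite open covers and Hausdorff dimension *)

Section hausdorff_small.
Context {R : realType} {T : metricType R} (t : R) (t0 : 0 < t).
Implicit Types A B C U : set T.

Lemma diam_le A (r : R) : 0 <= r -> (forall x y, A x -> A y -> mdist x y <= r) ->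
  (diam A <= r%:E)%E.
Proof.
move=> r0 Ar; rewrite /diam ge_max lee_fin r0 /=.
by apply: ge_ereal_sup => _ [[x y] /= [Ax Ay] <-]; rewrite lee_fin Ar.
Qed.

Lemma mdist_le_diam A x y : A x -> A y -> ((mdist x y)%:E <= diam A)%E.
Proof.
move=> Ax Ay; rewrite /diam le_max; apply/orP; right.
by apply: ereal_sup_ubound; exists (x, y).
Qed.

Lemma diam_ge0 A : (0 <= diam A)%E.
Proof. by rewrite /diam le_max lexx. Qed.

Lemma diam_pow_ge0 s A : (0 <= diam_pow s A)%E.
Proof. by rewrite /diam_pow; case: ifP => // _; exact: poweR_ge0. Qed.

Lemma diam_pow_le A (r : R) : 0 <= r -> (diam A <= r%:E)%E ->
  (diam_pow t A <= (r `^ t)%:E)%E.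
Proof.
move=> r0 Ar; rewrite /diam_pow; case: ifP => _; first by rewrite lee_fin powR_ge0.
rewrite -poweR_EFin; apply: gt0_ler_poweR => //; first exact: ltW.
- by rewrite in_itv /= diam_ge0 leey.
- by rewrite in_itv /= lee_fin r0 leey.
Qed.

(** Each [a ^ t] is below the total [e <= delta ^ t], so [a <= delta] and the cover is admissible at
    scale [delta]. *)
Lemma small_cover e A delta : small t e A -> 0 < delta -> e <= delta `^ t ->
  exists N (F : nat -> set T), [/\ A `<=` \bigcup_i F i,
    forall i, (diam (F i) <= delta%:E)%E, forall i, (N <= i)%N -> F i = set0 &
    (\sum_(i < N) diam_pow t (F i) <= e%:E)%E].
Proof.
move=> sA d0; elim: sA => {e A} [e A e0 A0 _|a e U A B a0 oU Ua sB IH AB aed].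
  exists 0%N, (fun=> set0); split => //; first by move=> x /A0.
    by move=> i; apply: diam_le => //; exact: ltW.
  by rewrite big_ord0 lee_fin ltW.
have ad : a <= delta.
  rewrite leNgt; apply/negP => da.
  have : delta `^ t < a `^ t by apply: gt0_ltr_powR; rewrite ?nnegrE ?ltW.
  have := small_gt0 sB; lra.
have [|N [F [BF Fd F0 sF]]] := IH.
  have := powR_ge0 a t; lra.
exists N.+1, (fun i => if i is k.+1 then F k else U); split.
- by move=> x /AB[Ux|/BF[i _ Fx]]; [exists 0%N|exists i.+1].
- case=> [|i //]; apply: le_trans (diam_le (ltW a0) Ua) _.
  by rewrite lee_fin.
- by case=> // i; rewrite ltnS; exact: F0.
- rewrite big_ord_recl /= EFinD; apply: leeD => //.
  by apply: diam_pow_le (diam_le _ Ua); exact: ltW.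
Qed.

Lemma dimH_le_small A : (forall e, 0 < e -> small t e A) -> (dimH A <= t%:E)%E.
Proof.
move=> sA; rewrite /dimH; case: ifP => _;
  first by rewrite lee_fin (le_trans _ (ltW t0))// lerN10.
apply: ereal_inf_lbound; exists t => //; split; first exact: ltW.
apply/eqP; rewrite eq_le; apply/andP; split; last first.
  apply: le_ereal_sup_tmp; exists (hausdorff_premeasure t 1 A); first by exists 1 => //=.
  apply: le_ereal_inf_tmp => _ [F _ <-]; apply: nneseries_ge0 => i _ _; exact: diam_pow_ge0.
apply: ge_ereal_sup => _ [d /= d0 <-]; apply/lee_addgt0Pr => e e0; rewrite add0e.
have dt0 : 0 < d `^ t by exact: powR_gt0.
have m0 : 0 < Num.min e (d `^ t) by rewrite lt_min e0.
have [|N [F [AF Fd F0 sF]]] := small_cover (sA _ m0) d0; first by rewrite ge_min lexx orbT.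
apply: (@le_trans _ _ (\sum_(0 <= i <oo) diam_pow t (F i))%E).
  by apply: ereal_inf_lbound; exists F.
rewrite (nneseries_split 0 N); last by move=> *; exact: diam_pow_ge0.
rewrite add0n [X in (_ + X)%E]eseries0; last first.
  by move=> i Ni _; rewrite F0// /diam_pow eqxx.
rewrite adde0 big_mkord (le_trans sF)// lee_fin ge_min lexx//.
Qed.

(** For the diameter [r <= 1] one has [r ^ t <= r ^ s]; the bound [a] solving [a ^ t = r ^ t + e]
    exceeds [r] and leaves room for an open thickening. *)
Lemma small_open_hull s A e : 0 <= s -> s < t -> 0 < e -> (diam A <= 1)%E ->
  exists a U, [/\ 0 < a, open U, A `<=` U, (forall x y, U x -> U y -> mdist x y <= a)
    & ((a `^ t)%:E <= diam_pow s A + e%:E)%E].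
Proof.
move=> s0 st e0 dA.
have [A0|A0] := eqVneq A set0.
  exists (e `^ t^-1), set0; split => //.
  - exact: powR_gt0.
  - exact: open0.
  - by rewrite A0.
  - by rewrite /diam_pow A0 eqxx add0e -powRrM (mulVf (lt0r_neq0 t0)) powRr1 ?lexx ?(ltW e0).
have [r rE] : exists r, diam A = r%:E.
  move: dA (diam_ge0 A); case: (diam A) => [r _ _|//|//]; by exists r.
have r0 : 0 <= r by have := diam_ge0 A; rewrite rE lee_fin.
have r1 : r <= 1 by move: dA; rewrite rE lee_fin.
pose a := (r `^ t + e) `^ t^-1.
have rt0 := powR_ge0 r t.
have ra : r < a.
  have {1}-> : r = (r `^ t) `^ t^-1 by rewrite -powRrM mulfV ?gt_eqF// powRr1.
  by apply: gt0_ltr_powR; rewrite ?invr_gt0 ?nnegrE//; lra.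
have aE : a `^ t = r `^ t + e.
  by rewrite /a -powRrM mulVf ?gt_eqF// powRr1//; lra.
have Ar x y : A x -> A y -> mdist x y <= r.
  by move=> Ax Ay; rewrite -lee_fin -rE; exact: mdist_le_diam.
exists a, (nbd ((a - r) / 2) A); split.
- exact: le_lt_trans ra.
- exact: open_nbd.
- by apply: sub_nbd; lra.
- by move=> x y xA yA; have := nbd_diam Ar xA yA; lra.
rewrite aE /diam_pow (negbTE A0) rE poweR_EFin -EFinD lee_fin lerD2r.
have [->|rn0] := eqVneq r 0; first by rewrite powR0 ?gt_eqF// powR_ge0.
by apply: ger_powR; [rewrite lt_neqAle eq_sym rn0 r0|exact: ltW].
Qed.

Lemma small_of_cover (a : nat -> R) (U : nat -> set T) A e :
  (forall i, 0 < a i) -> (forall i, open (U i)) ->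
  (forall i x y, U i x -> U i y -> mdist x y <= a i) ->
  compact A -> A `<=` \bigcup_i U i ->
  (\sum_(0 <= i <oo) (a i `^ t)%:E < e%:E)%E -> small t e A.
Proof.
move=> a0 oU Ua cA AU sU.
have [N AN] : exists N, A `<=` \bigcup_(i in [set i | (i < N)%N]) U i.
  apply: (compact_local_ind (Q := fun A => exists N,
    A `<=` \bigcup_(i in [set i | (i < N)%N]) U i)) cA _ _ _ _.
  - by exists 0%N.
  - by move=> B C BC [N CN]; exists N => x /BC/CN.
  - move=> B C [N BN] [M CM]; exists (maxn N M) => x [/BN|/CM] [i /= iN Ux];
      by exists i => //=; rewrite leq_max iN ?orbT.
  - move=> x Ax; have [i _ Ux] := AU x Ax; exists (U i).
      exact: open_nbhs_nbhs.
    by exists i.+1 => y [_ Uy]; exists i => /=.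
have sN : \sum_(i < N) a i `^ t < e.
  rewrite -lte_fin; apply: le_lt_trans sU; rewrite -sumEFin.
  rewrite -(big_mkord xpredT (fun i => (a i `^ t)%:E)).
  by apply: nneseries_lim_ge => i _ _; rewrite lee_fin powR_ge0.
elim: N e {sU} A {cA AU} AN sN => [|N IH] e A AN.
  by rewrite big_ord0 => e0; apply: small_nil => // x /AN[i].
rewrite big_ord_recr /= => sN; rewrite -(subrK (a N `^ t) e) addrC.
pose B := \bigcup_(i in [set i | (i < N)%N]) U i.
apply: (small_cons (a0 N) (oU N) (@Ua N) (IH _ B _ _)) => //.
- by rewrite ltrBrDr.
- move=> x /AN[i /= + Ux]; rewrite ltnS leq_eqVlt => /orP[/eqP iN|iN].
    by left; rewrite -iN.
  by right; exists i.
Qed.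

(** Some [s]-measure with [s < t] vanishes; scale 1 is enough, since there raising the exponent to
    [t] costs nothing. Opening the [i]-th set costs [e / 3 / 2 ^ i.+1], so the total stays below
    [2 * e / 3]. *)
Lemma small_of_dimH A e : compact A -> (dimH A < t%:E)%E -> 0 < e -> small t e A.
Proof.
move=> cA + e0; rewrite /dimH; case: ifP => [/eqP -> _|_]; first exact: small_nil.
move=> /ereal_inf_lt[_ [s [s0 sA] <-]]; rewrite lte_fin => st.
have e20 : 0 < e / 3 by lra.
have : (hausdorff_premeasure s 1 A < (e / 3)%:E)%E.
  apply: (@le_lt_trans _ _ 0%E); last by rewrite lte_fin.
  by rewrite -sA; apply: ereal_sup_ubound; exists 1 => /=.
move=> /ereal_inf_lt[_ [F [AF Fd] <-]] sF.
have en0 n : 0 < (e / 3) / (2 ^ n.+1)%:R :> R by rewrite divr_gt0// ltr0n expn_gt0.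
have /choice[a /choice[U aU]] n := small_open_hull s0 st (en0 n) (Fd n).
apply: (@small_of_cover a U) => //; [by move=> n; case: (aU n)..| |].
  by move=> x /AF[i _ Fx]; exists i => //; have [_ _ FU _ _] := aU i; exact: FU.
apply: (@le_lt_trans _ _ (\sum_(0 <= i <oo)
    (diam_pow s (F i) + ((e / 3) / (2 ^ i.+1)%:R)%:E))%E).
  apply: lee_nneseries => [i _ _|i _]; first by rewrite lee_fin powR_ge0.
  by have [] := aU i.
apply: le_lt_trans (@epsilon_trick _ (fun i => diam_pow s (F i)) (e / 3) xpredT
  (fun i => diam_pow_ge0 _ _) (ltW e20)) _.
apply: (@lt_le_trans _ _ ((e / 3)%:E + (e / 3)%:E)%E); last by rewrite -EFinD lee_fin; lra.
by rewrite lteD2rE.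
Qed.

End hausdorff_small.

(** * Clusters and coverable sets *)

Section clusters.
Context {R : realType} {T : metricType R}.
Implicit Types A B C D E U : set T.

(* [E] is split by the labels into finitely many clusters of diameter at most
   [d], any two of which are at distance at least [r]. *)
Definition clustered (r d : R) (N : nat) E (lab : T -> nat) : Prop :=
  forall x, E x -> (lab x < N)%N /\
    forall y, E y -> (mdist x y < r -> lab x = lab y) /\
                     (lab x = lab y -> mdist x y <= d).

Lemma clustered_sub r d N A B lab : A `<=` B -> clustered r d N B lab ->
  clustered r d N A lab.
Proof. by move=> AB cB x /AB/cB[labN H]; split => // y /AB/H. Qed.

Lemma clustered_le r r' d d' N N' E lab : r' <= r -> d <= d' -> (N <= N')%N ->
  clustered r d N E lab -> clustered r' d' N' E lab.
Proof.
move=> r'r dd' NN' cE x /cE[labN H]; split; first exact: leq_trans NN'.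
move=> y /H[H1 H2]; split => [xy|/H2/le_trans]; last exact.
by apply: H1; exact: lt_le_trans r'r.
Qed.

(** Each point inherits the label of a point of [E] within [e]; points less than [e] apart have
    representatives less than [3 * e <= r] apart, so their labels agree. *)
Lemma clustered_nbd r e d N E lab : 0 < e -> 3 * e <= r ->
  clustered r d N E lab ->
  exists lab', clustered e (d + 2 * e) N (nbd e E) lab'.
Proof.
move=> e0 er cE.
have /choice[p pE] x : exists y, nbd e E x -> E y /\ mdist y x < e.
  have [[y Ey yx]|nEx] := pselect (nbd e E x); first by exists y.
  by exists x => /nEx.
exists (lab \o p) => x /pE[Epx pxx]; have [labN H] := cE _ Epx.
split=> // y /pE[Epy pyy]; have [H1 H2] := H _ Epy; split=> [xy|/H2 pxy].
  apply: H1; have := metric_triangle (p x) x (p y); have := metric_triangle x y (p y).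
  by rewrite (metric_sym y (p y)); lra.
have := metric_triangle x (p x) y; have := metric_triangle (p x) (p y) y.
by rewrite (metric_sym x (p x)); lra.
Qed.

(* Each cluster of [E2] lying near [E1] is absorbed by the unique nearby
   cluster of [E1]. *)
Lemma clusteredU r1 d1 N1 E1 lab1 r2 d2 N2 E2 lab2 e : 0 < e ->
  0 <= d1 -> 0 <= d2 ->
  clustered r1 d1 N1 E1 lab1 -> clustered r2 d2 N2 E2 lab2 ->
  2 * e + d2 <= r1 -> e <= r2 ->
  exists lab, clustered e (d1 + 2 * (d2 + e) + d2) (maxn N1 N2).*2.+2 (E1 `|` E2) lab.
Proof.
move=> e0 d10 d20 c1 c2 er1 er2.
pose near k y := E1 y /\ exists2 x, E2 x & lab2 x = k /\ mdist x y < e.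
(* Two points of [E1] within [e] of one cluster of [E2] are less than [2 * e + d2 <= r1] apart,
   hence have the same label. *)
have near_lab k y y' : near k y -> near k y' -> lab1 y = lab1 y'.
  move=> [E1y [x E2x [xk xy]]] [E1y' [x' E2x' [x'k x'y']]].
  have [_ /(_ _ E1y')[+ _]] := c1 _ E1y; apply.
  have [_ /(_ _ E2x')[_ xx']] := c2 _ E2x.
  have := xx' (etrans xk (esym x'k)); rewrite (metric_sym x y) in xy.
  have := metric_triangle y x y'; have := metric_triangle x x' y'; lra.
(* Clusters of [E1] get even labels, clusters of [E2] away from [E1] odd ones, so the two kinds
   never collide. *)
have /choice[l2 l2E] k : exists l, (forall y, near k y -> l = (lab1 y).*2) /\
    ((forall y, ~ near k y) -> l = k.*2.+1).
  have [[y ky]|nk] := pselect (exists y, near k y).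
    exists (lab1 y).*2; split=> [y' /(near_lab _ _ _ ky) -> //|nk].
    by have := nk y.
  exists k.*2.+1; split=> // y ky; by case: nk; exists y.
have [lab [labE1 labE2]] : exists lab : T -> nat,
    (forall x, E1 x -> lab x = (lab1 x).*2) /\
    (forall x, E2 x -> lab x = l2 (lab2 x)).
  have /choice[lab labE] x : exists l, (E1 x -> l = (lab1 x).*2) /\ (E2 x -> l = l2 (lab2 x)).
    have [E1x|nE1x] := pselect (E1 x); last by exists (l2 (lab2 x)).
    exists (lab1 x).*2; split=> // E2x; apply/esym.
    have [+ _] := l2E (lab2 x); apply; split=> //; exists x => //; split=> //.
    by rewrite mdistxx.
  by exists lab; split=> x; case: (labE x).
have l2P k : (exists2 y, near k y & l2 k = (lab1 y).*2) \/ l2 k = k.*2.+1.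
  have [H1 H2] := l2E k; have [[y ky]|nk] := pselect (exists y, near k y).
    by left; exists y => //; exact: H1.
  by right; apply: H2 => y ky; apply: nk; exists y.
exists lab => x xE.
have labP z : (E1 `|` E2) z ->
    (exists y, [/\ E1 y, lab z = (lab1 y).*2 & mdist z y <= d2 + e]) \/
    [/\ E2 z, lab z = (lab2 z).*2.+1 & forall y, ~ near (lab2 z) y].
  case=> [E1z|E2z].
    by left; exists z; split; rewrite ?labE1// mdistxx; lra.
  rewrite labE2//; have [[y kE]|nk] := pselect (exists y, near (lab2 z) y).
    have [H1 _] := l2E (lab2 z); rewrite (H1 _ kE); left; exists y.
    have [E1y [w E2w [wz wy]]] := kE; split=> //.
    have [_ /(_ _ E2z)[_ /(_ wz)]] := c2 _ E2w.
    have := metric_triangle z w y; rewrite (metric_sym z w); lra.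
  right; split=> //.
    by have [_ ->] := l2E (lab2 z) => // y ky; apply: nk; exists y.
  by move=> y ky; apply: nk; exists y.
have near_eq a b : E1 a -> E2 b -> mdist a b < e -> lab a = lab b.
  move=> E1a E2b ab; rewrite labE1// labE2//.
  have [H _] := l2E (lab2 b); rewrite (H a)//; split=> //.
  by exists b => //; rewrite metric_sym.
split.
  have [[y [E1y -> _]]|[E2x -> _]] := labP x xE.
    have [ltN _] := c1 _ E1y.
    by rewrite ltnW// ltnS -[(maxn _ _).*2.+1]addn1 ltn_addr// ltn_double leq_max ltN.
  have [ltN _] := c2 _ E2x.
  by rewrite !ltnS leq_double leq_max (ltnW ltN) orbT.
move=> y yE; split.
  case: xE yE => [E1x|E2x] [E1y|E2y] xy.
  - rewrite !labE1//; congr _.*2.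
    by have [_ /(_ _ E1y)[+ _]] := c1 _ E1x; apply; lra.
  - exact: near_eq.
  - by apply/esym/near_eq => //; rewrite metric_sym.
  - rewrite !labE2//; congr l2.
    by have [_ /(_ _ E2y)[+ _]] := c2 _ E2x; apply; lra.
have [[x' [E1x' -> xx']]|[E2x -> nx]] := labP x xE;
  have [[y' [E1y' -> yy']]|[E2y -> ny]] := labP y yE.
- move=> /double_inj x'y'.
  have [_ /(_ _ E1y')[_ /(_ x'y')]] := c1 _ E1x'.
  have := metric_triangle x x' y; have := metric_triangle x' y' y.
  by rewrite (metric_sym y' y); lra.
- by move=> /(congr1 odd); rewrite /= !odd_double.
- by move=> /(congr1 odd); rewrite /= !odd_double.
- move=> [/double_inj xy].
  by have [_ /(_ _ E2y)[_ /(_ xy)]] := c2 _ E2x; lra.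
Qed.
End clusters.

Section coverable.
Context {R : realType} {T : metricType R} (t : R).
Implicit Types A B C D E U : set T.

Definition coverable (n : nat) C : Prop := forall e d : R, 0 < e -> 0 < d ->
  exists (V : set T) (r : R) (N : nat) (E : nat -> set T) (lab : nat -> T -> nat),
    [/\ open V, small t e V, 0 < r,
        C `<=` V `|` \bigcup_(j in [set j | (j < n)%N]) E j &
        forall j, (j < n)%N -> clustered r d N (E j) (lab j)].

Lemma coverable0 n : coverable n set0.
Proof.
move=> e d e0 d0; exists set0, 1, 0%N, (fun=> set0), (fun=> fun=> 0%N).
split => //; first exact: open0.
exact: small_nil.
Qed.

(** The cluster size for [C] is chosen after the gap [r1] for [B]: with diameter at most [r1 / 2],
    and [a <= r1 / 4], a cluster for [C] cannot bridge two clusters for [B]. *)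
Lemma coverableU n B C : coverable n B -> coverable n C -> coverable n (B `|` C).
Proof.
move=> cB cC e d e0 d0.
have e20 : 0 < e / 2 by lra.
have d20 : 0 < d / 2 by lra.
have [V1 [r1 [N1 [E1 [lab1 [oV1 sV1 r10 BV1 cE1]]]]]] := cB _ _ e20 d20.
pose d2 := Num.min (r1 / 2) (d / 10).
have d2r : d2 <= r1 / 2 by rewrite ge_min lexx.
have d2d : d2 <= d / 10 by rewrite ge_min lexx orbT.
have d2_0 : 0 < d2 by rewrite lt_min !divr_gt0.
have [V2 [r2 [N2 [E2 [lab2 [oV2 sV2 r20 CV2 cE2]]]]]] := cC _ _ e20 d2_0.
pose a := Num.min r2 (Num.min (r1 / 4) (d / 10)).
have ar2 : a <= r2 by rewrite ge_min lexx.
have ar1 : a <= r1 / 4 by rewrite !ge_min lexx orbT.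
have ad : a <= d / 10 by rewrite !ge_min lexx !orbT.
have a0 : 0 < a by rewrite !lt_min r20 !divr_gt0.
have /choice[lab labE] j : exists lab, (j < n)%N ->
    clustered a d (maxn N1 N2).*2.+2 (E1 j `|` E2 j) lab.
  have [jn|jn] := boolP (j < n)%N; last by exists (fun=> 0%N).
  have [||||lab labE] := clusteredU a0 _ _ (cE1 _ jn) (cE2 _ jn).
  - exact: ltW.
  - exact: ltW.
  - lra.
  - by [].
  by exists lab => _; apply: clustered_le labE => //; lra.
exists (V1 `|` V2), a, (maxn N1 N2).*2.+2, (fun j => E1 j `|` E2 j), lab; split => //.
- exact: openU.
- by rewrite (splitr e); exact: smallU.
- move=> x [/BV1|/CV2] [?|[j jn Ex]].
  + by left; left.
  + by right; exists j => //; left.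
  + by left; right.
  + by right; exists j => //; right.
Qed.

(** Finitely many [W] cover [C]. Off the union of their exceptional sets [B], membership in each [W]
    is locally constant, so the index of the first [W] containing a point labels one new family of
    clusters. *)
Lemma coverable_step n C : compact C ->
  (forall x d, C x -> 0 < d -> exists W B, [/\ nbhs x W,
     forall y z, C y -> C z -> W y -> W z -> mdist y z <= d, coverable n B &
     forall y, C y -> ~ B y -> exists2 r, 0 < r &
       forall z, C z -> mdist y z < r -> W z <-> W y]) ->
  coverable n.+1 C.
Proof.
move=> cC HC e d e0 d0.
have [N [W [B [CW Wd cB WB]]]] : exists N (W : nat -> set T) B,
    [/\ C `<=` \bigcup_(i in [set i | (i < N)%N]) W i,
        forall i y z, (i < N)%N -> C y -> C z -> W i y -> W i z -> mdist y z <= d,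
        coverable n B &
        forall y, C y -> ~ B y -> exists2 r, 0 < r &
          forall i z, (i < N)%N -> C z -> mdist y z < r -> W i z <-> W i y].
  apply: (compact_local_ind (Q := fun A => exists N (W : nat -> set T) B,
    [/\ A `<=` \bigcup_(i in [set i | (i < N)%N]) W i,
        forall i y z, (i < N)%N -> C y -> C z -> W i y -> W i z -> mdist y z <= d,
        coverable n B &
        forall y, C y -> ~ B y -> exists2 r, 0 < r &
          forall i z, (i < N)%N -> C z -> mdist y z < r -> W i z <-> W i y])) cC _ _ _ _.
  - exists 0%N, (fun=> set0), set0; split => //; first exact: coverable0.
    by move=> y _ _; exists 1.
  - move=> A A' AA' [N [W [B [A'W Wd cB WB]]]]; exists N, W, B; split => //.
    by move=> x /AA'/A'W.
  - move=> A A' [N [W [B [AW Wd cB WB]]]] [N' [W' [B' [AW' Wd' cB' WB']]]].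
    exists (N + N')%N, (fun i => if (i < N)%N then W i else W' (i - N)%N), (B `|` B'); split.
    + move=> x [/AW[i /= iN Wx]|/AW'[i /= iN Wx]].
        by exists i; rewrite /= ?iN// ltn_addr.
      by exists (N + i)%N; rewrite /= ?ltn_add2l// ltnNge leq_addr /= addKn.
    + move=> i y z iN; case: ltnP => [|Ni]; first exact: Wd.
      by apply: Wd'; rewrite ltn_subLR.
    + exact: coverableU.
    + move=> y Cy /not_orP[/(WB _ Cy)[r r0 rW] /(WB' _ Cy)[r' r'0 rW']].
      exists (Num.min r r'); first by rewrite lt_min r0.
      move=> i z iN Cz; rewrite lt_min => /andP[zr zr'].
      case: ltnP => [iltN|Ni]; first exact: rW.
      by apply: rW' => //; rewrite ltn_subLR.
  - move=> x Cx; have [W [B [xW Wd cB WB]]] := HC x d Cx d0.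
    exists W => //; exists 1%N, (fun=> W), B; split => //.
    + by move=> y [_ Wy]; exists 0%N.
    + by move=> _ y z _; exact: Wd.
    + by move=> y Cy /(WB _ Cy)[r r0 rW]; exists r => // _ z _; exact: rW.
have d20 : 0 < d / 2 by lra.
have [V [r [N' [E [lab [oV sV r0 BV cE]]]]]] := cB _ _ e0 d20.
(* Thickening the old families makes them open, so that the remainder [F] is compact; cluster
   diameters stay within [d / 2 + 2 * a <= d]. *)
pose a := Num.min (r / 3) (d / 4).
have ar : a <= r / 3 by rewrite ge_min lexx.
have ad : a <= d / 4 by rewrite ge_min lexx orbT.
have a0 : 0 < a by rewrite lt_min !divr_gt0.
have /choice[lab' lab'E] j : exists lab', (j < n)%N -> clustered a d N' (nbd a (E j)) lab'.
  have [jn|jn] := boolP (j < n)%N; last by exists (fun=> 0%N).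
  have [|lab' lab'E] := clustered_nbd a0 _ (cE _ jn); first lra.
  by exists lab' => _; apply: clustered_le lab'E => //; lra.
pose F := C `\` (V `|` \bigcup_(j in [set j | (j < n)%N]) nbd a (E j)).
have cF : compact F.
  apply: (sub_compact cC); last by move=> x [].
  apply: closedI; first exact: compact_closedT.
  apply: open_closedC; apply: openU => //; apply: bigcup_open => j _.
  exact: open_nbd.
have FB x : F x -> ~ B x.
  move=> [_ nVx] /BV[Vx|[j jn Ex]]; apply: nVx; [by left|right; exists j => //].
  exact: sub_nbd.
pose idx z := find (fun i => `[< W i z >]) (iota 0 N).
have idxP z : C z -> (idx z < N)%N /\ W (idx z) z.
  move=> Cz; have hasW : has (fun i => `[< W i z >]) (iota 0 N).
    have [i /= iN Wz] := CW _ Cz; apply/hasP; exists i; last exact/asboolP.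
    by rewrite mem_iota add0n.
  have := hasW; rewrite has_find size_iota => idxN; split=> //.
  by have /asboolP := nth_find 0%N hasW; rewrite nth_iota.
have [r' r'0 r'P] : exists2 r, 0 < r &
    forall x, F x -> F x -> forall z, F z -> mdist x z < r -> idx x = idx z.
  apply: compact_uniform => // x Fx.
  have [Cx _] := Fx; have [r1 r10 r1W] := WB _ Cx (FB _ Fx).
  exists (r1 / 2); first lra.
  move=> y r2 xy r20 r2r [Cy _] z [Cz _] yz.
  apply: eq_in_find => i; rewrite mem_iota add0n => /= iN.
  apply/asbool_equiv_eq.
  have xz : mdist x z < r1 by have := metric_triangle x y z; lra.
  by split=> [/(r1W _ _ iN Cy)|/(r1W _ _ iN Cz xz)] H; [apply/(r1W _ _ iN Cz xz)/H; lra
    |apply/(r1W _ _ iN Cy) => //; lra].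
pose m := Num.min a r'.
exists V, m, (maxn N N'), (fun j => if (j < n)%N then nbd a (E j) else F),
  (fun j => if (j < n)%N then lab' j else idx); split => //.
- by rewrite lt_min a0.
- move=> x Cx; have [[Vx|[j /= jn Ex]]|nx] :=
      pselect ((V `|` \bigcup_(j in [set j | (j < n)%N]) nbd a (E j)) x).
  + by left.
  + by right; exists j; rewrite /= ?jn// ltnW.
  + by right; exists n; rewrite /= ?ltnn.
- move=> j _; case: ltnP => jn.
    apply: clustered_le (lab'E j jn) => //; first by rewrite ge_min lexx.
    by rewrite leq_maxr.
  move=> x Fx; have [Cx _] := Fx; have [idxN Wx] := idxP _ Cx; split.
    by rewrite leq_max idxN.
  move=> y Fy; have [Cy _] := Fy; have [_ Wy] := idxP _ Cy; split.
    by rewrite lt_min => /andP[_]; exact: r'P.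
  by move=> xy; apply: (Wd (idx x)) => //; rewrite xy.
Qed.

End coverable.

(** * Bases of subspaces *)

Section subspace_basis.
Context {R : realType} {T : metricType R}.
Implicit Types A B C U W : set T.

Lemma nbhs_set_typeP C (a : C) (U : set C) : nbhs a U <->
  exists2 r, 0 < r & forall b : C, mdist (\val a) (\val b) < r -> U b.
Proof.
split=> [[_ [[V oV <-] Va VU]]|[r r0 rU]].
  have /open_metricP oV' := oV; have [r r0 rV] := oV' _ Va.
  by exists r => // b ab; apply: VU; exact: rV.
exists (set_val @^-1` (ball (\val a) r)); split.
- exists (nbd r [set \val a]); first exact: open_nbd.
  apply/seteqP; split=> y /=; rewrite ballEmdist /nbd /=; first by case=> ? ->.
  by exists (\val a).
- by rewrite /= ballEmdist /= mdistxx.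
- by move=> b; rewrite /= ballEmdist => /rU.
Qed.

Lemma closed_boundary_image C (U : set C) : closed C ->
  closed (set_val @` boundary U).
Proof.
move=> /closed_metricP cC; apply/closed_metricP => x nx.
have [Cx|/cC[r r0 rC]] := pselect (C x); last first.
  by exists r => // y xy [b _ by_]; apply: (rC y xy); rewrite -by_; exact: set_valP.
pose a : C := exist _ x (mem_set Cx).
have : nbhs a (~` boundary U).
  apply: open_nbhs_nbhs; split; last by move=> ba; apply: nx; exists a.
  rewrite /boundary setDE setCI setCK; apply: openU; last exact: open_interior.
  exact/closed_openC/closed_closure.
move=> /nbhs_set_typeP[r r0 rU]; exists r => // y xy [b bU by_].
by apply: rU bU; rewrite -set_valE by_.
Qed.

(** [W] is an open set of the ambient space whose trace on [C] is a basic set. Only this trace is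
    controlled, so everything is stated for points of [C]. *)
Lemma basis_boundary_elim (Pr : set T -> Prop) C x d :
  basis_with_boundaries Pr C -> C x -> 0 < d ->
  exists W B, [/\ nbhs x W,
    forall y z, C y -> C z -> W y -> W z -> mdist y z <= d,
    Pr B, closed C -> closed B /\ B `<=` C &
    forall y, C y -> ~ B y -> exists2 r, 0 < r &
       forall z, C z -> mdist y z < r -> W z <-> W y].
Proof.
move=> [B [Bo Bb] BP] Cx d0.
pose a : C := exist _ x (mem_set Cx).
have : nbhs a [set b | mdist x (\val b) < d / 2].
  by apply/nbhs_set_typeP; exists (d / 2); [lra|].
move=> /Bb[U [BU Ua] Ud].
have [W oW WU] := Bo _ BU.
have WE y (Cy : C y) : W y <-> U (exist _ y (mem_set Cy)) by rewrite -WU.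
exists W, (set_val @` boundary U); split.
- by apply: open_nbhs_nbhs; split => //; apply/WE;
    rewrite (Prop_irrelevance (mem_set _) (mem_set Cx)).
- move=> y z Cy Cz /(WE _ Cy)/Ud /= xy /(WE _ Cz)/Ud /= xz.
  by have := metric_triangle y x z; rewrite (metric_sym y x); lra.
- exact: BP.
- by move=> cC; split; [exact: closed_boundary_image|move=> y [b _ <-]; exact: set_valP].
move=> y Cy nBy; pose b : C := exist _ y (mem_set Cy).
have [/nbhs_set_typeP[r r0 rU]|nint] := pselect (nbhs b U).
  exists r => // z Cz yz; split=> _; [apply/(WE _ Cy)|apply/(WE _ Cz)]; apply: rU => //=.
  by rewrite mdistxx.
have : nbhs b (~` U).
  apply: contrapT => nb; apply: nBy; exists b => //; split; last exact: nint.
  move=> V bV; apply: contrapT => UV0; apply: nb; apply: filterS bV => c Vc Uc.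
  by apply: UV0; exists c.
move=> /nbhs_set_typeP[r r0 rU].
exists r => // z Cz yz; split=> Wz; exfalso.
  by apply: (rU (exist _ z (mem_set Cz)) yz); apply/(WE _ Cz).
have := rU b; rewrite mdistxx => /(_ r0); apply; exact/(WE _ Cy).
Qed.

(** Relative to [A], the boundary of [U] misses the open set [U] and the open set [W] disjoint from
    it. As [W] takes all points at distance at least [r], the trace of [U] lies in the ball of
    radius [r]. *)
Lemma basis_boundary_intro (Pr : set T -> Prop) A : closed A ->
  (forall x r, A x -> 0 < r -> exists U W, [/\ open U /\ open W, U x,
     forall y, A y -> U y -> ~ W y, forall y, A y -> r <= mdist x y -> W y &
     forall B, closed B -> B `<=` A `\` (U `|` W) -> Pr B]) ->
  basis_with_boundaries Pr A.
Proof.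
move=> cA HA.
exists [set U | open U /\ Pr (set_val @` boundary U)]; last by move=> U [].
split; first by move=> U [].
move=> a S /nbhs_set_typeP[r r0 rS].
have [U [W [[oU oW] Ua UW rW UWP]]] := HA _ _ (set_valP a) r0.
pose U' : set A := set_val @^-1` U.
have oU' : open U' by exists U.
exists U'; last first.
  move=> b Ub; apply: rS; rewrite ltNge; apply/negP => rab.
  by apply: (UW _ (set_valP b) Ub); apply: rW => //; exact: set_valP.
split=> //; split=> //; apply: UWP; first exact: closed_boundary_image.
move=> _ [b [clb nib] <-]; split; first exact: set_valP.
case=> [Ub|Wb].
  by apply: nib; apply: open_nbhs_nbhs.
have bW : nbhs b (set_val @^-1` W) by apply: open_nbhs_nbhs; split=> //; exists W.
have [c [Uc Wc]] := clb _ bW.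
by apply: (UW _ (set_valP c) Uc).
Qed.

End subspace_basis.

(** * Coverability from a dimension bound *)

Section dim_tH_coverable.
Context {R : realType} {T : metricType R} (t : R) (t0 : 0 < t).

Lemma inductive_step_lt (D : set T -> \bar R) (A : set T) (r : R) :
  (inductive_step D A < r%:E)%E ->
  basis_with_boundaries (fun V => D V < (r - 1)%:E)%E A.
Proof.
move=> /ereal_inf_lt[d /= bd dr]; apply: basis_with_boundaries_sub bd => V /le_lt_trans; apply.
by move: d dr => [d| |]//=; rewrite ?lte_fin ?ltNyr//; lra.
Qed.

Lemma coverable_dim_tH n (C : set T) : compact C ->
  (dim_tH n C < (t + n%:R)%:E)%E -> coverable t n C.
Proof.
elim: n C => [C cC|n IH C cC].
  rewrite /= addr0 => dC e d e0 d0.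
  have [V [oV CV sV]] := small_open (small_of_dimH t0 cC dC e0).
  exists V, 1, 0%N, (fun=> set0), (fun=> fun=> 0%N); split => // x /CV; by left.
rewrite /=; case: ifP => [/eqP -> _|_]; first exact: coverable0.
move=> /inductive_step_lt; rewrite -natr1 addrA addrK => bC.
apply: coverable_step => // x d Cx d0.
have [W [B [xW Wd BP cB Wloc]]] := basis_boundary_elim bC Cx d0.
have [clB BC] := cB (compact_closedT cC).
exists W, B; split => //; apply: IH => //; exact: sub_compact BC.
Qed.

End dim_tH_coverable.

(** * Approximation by functions with thin fibers *)

Section continuous_functions.
Context {R : realType} {T : metricType R}.

Lemma continuous_metricP {V : pseudoMetricNormedZmodType R} (f : T -> V) :
  continuous f <-> forall x e, 0 < e ->
    exists2 r, 0 < r & forall y, mdist x y < r -> `|f x - f y| < e.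
Proof.
split=> [cf x e e0|H x].
  have /cvgr_dist_lt/(_ e e0) := cf x.
  move=> /nbhs_ballP[r /= r0 rP]; exists r => // y xy; apply: rP.
  by rewrite ballEmdist.
apply/cvgrPdist_lt => e e0; have [r r0 rP] := H x e e0.
by apply/nbhs_ballP; exists r => // y; rewrite ballEmdist => /rP.
Qed.

Lemma within_continuous_metricP {V : pseudoMetricNormedZmodType R} (A : set T)
    (f : T -> V) : (forall x e, A x -> 0 < e ->
    exists2 r, 0 < r & forall y, A y -> mdist x y < r -> `|f x - f y| < e) ->
  {within A, continuous f}.
Proof.
move=> H; apply/subspace_continuousP => x Ax.
apply/cvgrPdist_lt => e e0; have [r r0 rP] := H x e Ax e0.
by apply/nbhs_ballP; exists r => // y; rewrite ballEmdist => /= xy Ay; exact: rP.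
Qed.

Lemma rV_norm_ltP n (v : 'rV[R]_n) (e : R) : 0 < e ->
  (`|v| < e) <-> (forall j, `|v 0 j| < e).
Proof.
move=> e0; rewrite [`|v|]mx_normrE; split.
  by move=> /bigmax_ltP[_ H] j; exact: (H (0, j)).
by move=> H; apply/bigmax_ltP; split=> // -[i j] _; rewrite (ord1 i); exact: H.
Qed.

Lemma continuous_row n (h : 'I_n -> T -> R) : (forall j, continuous (h j)) ->
  continuous (fun x => \row_j h j x : 'rV[R]_n).
Proof.
move=> hc; apply/continuous_metricP => x e e0.
have /choice[r rP] j : exists r, 0 < r /\ forall y, mdist x y < r -> `|h j x - h j y| < e.
  by have /continuous_metricP/(_ x e e0)[r r0 rP] := hc j; exists r.
exists (\big[Num.min/1]_j r j).
  by apply/bigmin_gtP; split=> // j _; case: (rP j).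
move=> y xy; apply/rV_norm_ltP => // j; rewrite !mxE.
have [_] := rP j; apply; apply: lt_le_trans xy _; exact: bigmin_le_cond.
Qed.

Lemma continuous_coord n (f : T -> 'rV[R]_n) j : continuous f ->
  continuous (fun x => f x 0 j).
Proof.
move=> cf x; apply: (@continuous_comp _ _ _ f (fun v : 'rV[R]_n => v 0 j) x (cf x)).
exact: coord_continuous.
Qed.

Lemma compact_unif_continuous {V : pseudoMetricNormedZmodType R} (f : T -> V) :
  compact [set: T] -> continuous f -> forall e, 0 < e ->
  exists2 r, 0 < r & forall x y, mdist x y < r -> `|f x - f y| < e.
Proof.
move=> cT /continuous_metricP cf e e0.
have [r r0 rP] : exists2 r, 0 < r &
    forall x, [set: T] x -> forall y, mdist x y < r -> `|f x - f y| < e.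
  apply: compact_uniform => // x _; have [|r r0 rP] := cf x (e / 2); first lra.
  exists (r / 2); first lra.
  move=> y r' xy r'0 r'r z yz.
  have xz : mdist x z < r by have := metric_triangle x y z; lra.
  have {}xy : mdist x y < r by lra.
  rewrite -(subrK (f x) (f y)) -addrA (splitr e).
  apply: le_lt_trans (ler_normD _ _) (ltrD _ _); last exact: rP.
  by rewrite distrC; exact: rP.
by exists r => // x y; exact: rP.
Qed.

End continuous_functions.

Section thin_fibers.
Context {R : realType} {T : metricType R}.
Context (cT : compact [set: T]).

(** Tietze extension is applied to [v - f], not to [v], so that its bound [e] becomes closeness of
    [h] to [f]. *)
Lemma tietze_approx (E : set T) (f v : T -> R) (e : R) : closed E -> 0 < e ->
  continuous f ->
  (forall x, E x -> exists2 r, 0 < r & forall y, E y -> mdist x y < r -> v y = v x) ->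
  (forall x, E x -> `|v x - f x| <= e) ->
  exists h : T -> R, [/\ continuous h, forall x, `|h x - f x| <= e &
    forall x, E x -> h x = v x].
Proof.
move=> cE e0 cf vloc vf.
have normalT : normal_space T := compact_normal (@metric_hausdorff _ T) cT.
have [] := @continuous_bounded_extension T R normalT E cE (fun x => v x - f x) e e0 _ vf.
  apply: within_continuous_metricP => x a Ex a0.
  have [r r0 rP] := vloc x Ex.
  have /continuous_metricP/(_ x a a0)[r' r'0 r'P] := cf.
  exists (Num.min r r'); first by rewrite lt_min r0.
  move=> y Ey; rewrite lt_min => /andP[xr /r'P fxy]; rewrite (rP _ Ey xr).
  have -> : v x - f x - (v x - f y) = f y - f x by ring.
  by rewrite distrC.
move=> g [gE cg ge]; exists (fun x => g x + f x); split.
- by move=> x; apply: cvgD; [exact: cg|exact: cf].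
- by move=> x; rewrite addrK.
- by move=> x Ex; rewrite -gE ?inE// subrK.
Qed.

(** On the cluster labelled [k], the value is [eta] times an integer congruent to [k] modulo [N.+1],
    so different labels give values at least [eta] apart. For each [k] such values occur with step
    [e / 4], hence close to [f]. *)
Lemma spread_values (E : set T) (f : T -> R) r d N lab (e : R) : 0 < e -> 0 < r ->
  closed E -> continuous f -> clustered r d N E lab ->
  (forall x y, mdist x y <= d -> `|f x - f y| < e / 4) ->
  exists (h : T -> R) (eta : R), [/\ continuous h, forall x, `|h x - f x| <= 3 / 4 * e,
    0 < eta & forall x y, E x -> E y -> `|h x - h y| < eta -> lab x = lab y].
Proof.
move=> e0 r0 cE cf clE fd.
pose eta := e / 4 / N.+1%:R.
have eta0 : 0 < eta by rewrite !divr_gt0.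
have /choice[m mP] k : exists m : int, forall x, E x -> lab x = k ->
    `|eta * (N.+1%:Z * m + k%:Z)%:~R - f x| <= 3 / 4 * e.
  have [[x [Ex xk]]|nE] := pselect (exists x, E x /\ lab x = k); last first.
    by exists 0 => x Ex xk; exfalso; apply: nE; exists x.
  (* The value and [f x] both lie between [e / 4 * m] and [e / 4 * m + e / 4]; on the rest of the
     cluster [f] moves by less than [e / 4]. *)
  exists (Num.floor (f x * 4 / e)) => y Ey yk.
  have [kN /(_ _ Ey)[_ /(_ (etrans xk (esym yk)))/fd]] := clE _ Ex.
  rewrite xk in kN; set m := Num.floor _.
  have mle : m%:~R <= f x * 4 / e by exact: real_floor_le (num_real _).
  have mgt : f x * 4 / e < m%:~R + 1.
    by rewrite -(intrD _ m 1%Z); exact: real_floorD1_gt (num_real _).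
  have -> : eta * (N.+1%:Z * m + k%:Z)%:~R = e / 4 * m%:~R + eta * k%:R.
    rewrite intrD intrM mulrDr; congr (_ + _).
    by rewrite mulrA /eta -[N.+1%:~R]/(N.+1%:R) divfK// pnatr_eq0.
  have k0 : 0 <= eta * k%:R by rewrite mulr_ge0// ltW.
  have k1 : eta * k%:R <= e / 4.
    rewrite /eta -mulrA ler_piMr//; first lra.
    by rewrite mulrC ler_pdivrMr ?ltr0n// mul1r ler_nat ltnW// ltnS ltnW.
  have m1 : e / 4 * m%:~R <= f x.
    have -> : f x = e / 4 * (f x * 4 / e) by field; rewrite gt_eqF.
    by rewrite ler_wpM2l//; lra.
  have m2 : f x < e / 4 * m%:~R + e / 4.
    have -> : f x = e / 4 * (f x * 4 / e) by field; rewrite gt_eqF.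
    have -> : e / 4 * m%:~R + e / 4 = e / 4 * (m%:~R + 1) by ring.
    by rewrite ltr_pM2l//; lra.
  by rewrite ltr_norml => /andP[? ?]; rewrite ler_norml; apply/andP; split; lra.
pose M k := N.+1%:Z * m k + k%:Z.
have [|||h [ch hf hE]] :=
  @tietze_approx E f (fun x => eta * (M (lab x))%:~R) (3 / 4 * e) cE _ cf.
- lra.
- move=> x Ex; exists r => // y Ey xy.
  by have [_ /(_ _ Ey)[/(_ xy) -> _]] := clE _ Ex.
- by move=> x Ex; exact: mP.
exists h, eta; split => // x y Ex Ey; rewrite !hE// -mulrBr normrM gtr0_norm//.
rewrite -[ltRHS]mulr1 ltr_pM2l// -intrB -intr_norm -[1]/(1%:~R) ltr_int.
have [xN _] := clE _ Ex; have [yN _] := clE _ Ey.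
have M0 (a b : int) : `|a - b| < 1 -> a = b.
  rewrite ltr_norml => /andP[]. lia.
move=> /M0.
move=> /(congr1 (fun z => (z %% N.+1)%Z)).
rewrite /M !(mulrC N.+1%:Z) !modzMDl !modz_small ?lez_nat
  ?ltz_nat ?leq0n ?ltnS ?(ltnW xN) ?(ltnW yN)//.
by case.
Qed.

End thin_fibers.

Section thin_functions.
Context {R : realType} {T : metricType R} (t : R) (t0 : 0 < t) (n : nat).
Context (cT : compact [set: T]).
Local Notation C := (continuousType T 'rV[R]_n).

(** Tubes replace fibers, and one [eta] serves all [y]; this makes the condition stable under
    uniformly small perturbations. *)
Definition thin (e : R) (f : T -> 'rV[R]_n) : Prop :=
  exists2 eta, 0 < eta & forall y, small t e [set x | `|f x - y| < eta].

Lemma thin_near e (f g : T -> 'rV[R]_n) eta : 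
  (forall y, small t e [set x | `|f x - y| < eta]) -> 0 < eta ->
  (forall x, `|f x - g x| < eta / 2) -> thin e g.
Proof.
move=> fthin eta0 fg; exists (eta / 2) => [|y]; first by rewrite divr_gt0.
apply: small_sub (fthin y) => x /= gy; rewrite -(subrK (g x) (f x)) -addrA (splitr eta).
exact: le_lt_trans (ler_normD _ _) (ltrD _ _).
Qed.

(** Coordinate [j] is spread over the clusters of the [j]-th family. A narrow tube over [y] then
    lies in [V] together with at most one cluster of each family. *)
Lemma thin_dense : coverable t n [set: T] -> forall (f : C) (e eps : R),
  0 < e -> 0 < eps -> exists g : C, (forall x, `|f x - g x| < eps) /\ thin e g.
Proof.
move=> covT f e eps e0 eps0.
have cf : continuous f := @cts_fun _ _ f.
pose e1 := e / 2 / n.+1%:R.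
have e10 : 0 < e1 by rewrite !divr_gt0.
have eps40 : 0 < eps / 4 by lra.
have [delta delta0 fdelta] := compact_unif_continuous cT cf eps40.
(* The first bound makes [f] vary by less than [eps / 4] on a cluster; the second gives a cluster
   content below [e1]. *)
pose d := Num.min (delta / 2) ((e1 / 2) `^ t^-1 / 2).
have d0 : 0 < d by rewrite lt_min !divr_gt0// powR_gt0// divr_gt0.
have ddelta : d <= delta / 2 by rewrite ge_min lexx.
have d1 : (2 * d) `^ t < e1.
  have de : 2 * d <= (e1 / 2) `^ t^-1.
    have : d <= (e1 / 2) `^ t^-1 / 2 by rewrite ge_min lexx orbT.
    lra.
  apply: le_lt_trans (ge0_ler_powR (ltW t0) _ _ de) _.
  - by rewrite nnegrE; lra.
  - by rewrite nnegrE powR_ge0.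
  - by rewrite -powRrM mulVf ?gt_eqF// powRr1; lra.
have e20 : 0 < e / 2 by lra.
have d20 : 0 < d / 2 by lra.
have [V [r [N [E [lab [oV sV r0 TV clE]]]]]] := covT _ _ e20 d20.
pose a := Num.min (r / 3) (d / 4).
have ar : a <= r / 3 by rewrite ge_min lexx.
have ad : a <= d / 4 by rewrite ge_min lexx orbT.
have a0 : 0 < a by rewrite lt_min !divr_gt0.
have spread (j : 'I_n) : exists l (h : T -> R) eta,
    [/\ clustered a d N (closure (E j)) l, continuous h,
      forall x, `|h x - f x 0 j| <= 3 / 4 * eps, 0 < eta &
      forall x y, closure (E j) x -> closure (E j) y -> `|h x - h y| < eta -> l x = l y].
  (* Extension requires closed sets; the closure of [E j] lies in a thickening that is still
     clustered. *)
  have [|l lE] := clustered_nbd a0 _ (clE j (ltn_ord j)); first lra.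
  have {}lE : clustered a d N (closure (E j)) l.
    apply: clustered_sub (closure_sub_nbd a0) _.
    by apply: clustered_le lE => //; lra.
  have fjd x y : mdist x y <= d -> `|f x 0 j - f y 0 j| < eps / 4.
    move=> xy; have /(rV_norm_ltP _ eps40)/(_ j) : `|f x - f y| < eps / 4.
      by apply: fdelta; lra.
    by rewrite !mxE.
  have [h [eta [ch hf eta0 hl]]] := spread_values cT eps0 a0
    (@closed_closure _ (E j)) (@continuous_coord _ _ _ _ j cf) lE fjd.
  by exists l, h, eta.
have /choice[l /choice[h /choice[eta spr]]] := spread.
have ch : continuous (fun x => \row_j h j x : 'rV[R]_n).
  by apply: continuous_row => j; case: (spr j).
pose g : C := mkcts ch.
exists g; split=> [x|].
  apply/rV_norm_ltP => // j; have [_ _ hf _ _] := spr j.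
  rewrite !mxE distrC; apply: le_lt_trans (hf x) _; lra.
pose eta0 := \big[Num.min/1]_j eta j.
have eta00 : 0 < eta0.
  by apply/bigmin_gtP; split=> // j _; case: (spr j).
exists (eta0 / 2) => [|y]; first by rewrite divr_gt0.
(* Contains the part of the tube in [E i]. Two of its points have [i]-th values less than
   [eta0 <= eta i] apart, hence share a cluster. *)
pose A i := [set x | exists lt_in : (i < n)%N, E i x /\
  `|h (Ordinal lt_in) x - y 0 (Ordinal lt_in)| < eta0 / 2].
have sA : small t (n.+1%:R * e1) (\bigcup_(i in [set i | (i < n)%N]) A i).
  apply: small_bigU => // i lt_in; apply: (small_diam d0) d1 => // u w.
  move=> [ltu [Eu hu]] [ltw [Ew hw]].
  rewrite (bool_irrelevance ltw ltu) in hw.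
  have [cl _ _ _ hl] := spr (Ordinal ltu).
  have Eu' := subset_closure Eu; have Ew' := subset_closure Ew.
  have [_ /(_ _ Ew')[_]] := cl _ Eu'; apply; apply: hl => //.
  apply: (@lt_le_trans _ _ eta0); last exact: bigmin_le_cond.
  rewrite -(subrK (y 0 (Ordinal ltu)) (h _ u)) -addrA (splitr eta0).
  by apply: le_lt_trans (ler_normD _ _) (ltrD _ _) => //; rewrite distrC.
have -> : e = e / 2 + n.+1%:R * e1.
  by rewrite [n.+1%:R * _]mulrC divfK ?pnatr_eq0// -splitr.
apply: small_sub (smallU sV sA) => x /= gy.
have [Vx|[i /= lt_in Ex]] := TV x I; first by left.
right; exists i => //; exists lt_in; split => //.
have eta20 : 0 < eta0 / 2 by lra.
have /(rV_norm_ltP _ eta20)/(_ (Ordinal lt_in)) := gy.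
by rewrite !mxE.
Qed.

End thin_functions.

(** * Nowhere dense sets of functions and partitions *)

Section category.

(** [meager] asks for equality with a union over [nat]: the sets are cut down to [A], and indices
    that decode to nothing get the empty set. *)
Lemma meager_cover (X : topologicalType) (I : countType) (F : I -> set X) (A : set X) :
  (forall i, nowhere_dense (F i)) -> A `<=` \bigcup_i F i -> meager A.
Proof.
move=> ndF AF.
exists (fun k => A `&` if unpickle k is Some i then F i else set0).
  move=> k; rewrite /nowhere_dense -subset0; case: (unpickle k) => [i|].
    apply: subset_trans (_ : interior (closure (F i)) `<=` _); last by rewrite ndF.
    by apply: interiorS; apply: closureS; exact: subIsetr.
  by rewrite setI0 closure0; exact: interior_subset.
apply/seteqP; split=> [x Ax|x [k _ []//]].
by have [i _ Fx] := AF x Ax; exists (pickle i) => //; rewrite pickleK.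
Qed.

Lemma nowhere_dense_continuousType (R : realType) (K : metricType R) (n : nat)
    (A : set (continuousType K 'rV[R]_n)) :
  (forall (f : continuousType K 'rV[R]_n) e, 0 < e ->
    exists2 g : continuousType K 'rV[R]_n, (forall x, `|f x - g x| < e) &
    exists2 eta, 0 < eta & forall h : continuousType K 'rV[R]_n,
      (forall x, `|g x - h x| < eta) -> ~ A h) -> nowhere_dense A.
Proof.
move=> HA; rewrite /nowhere_dense -subset0 => f /nbhs_continuousType[e e0 eA].
have [g fg [eta eta0 gA]] := HA f e e0.
have [|h [Ah]] := eA g fg [set h : continuousType K 'rV[R]_n | ~ A h]; last by [].
by apply/nbhs_continuousType; exists eta.
Qed.

End category.

Section partitions.
Context {R : realType} {T : metricType R}.
Context (cT : compact [set: T]).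
Implicit Types A B C U W : set T.

Definition closed_pair A B := [/\ closed A, closed B & forall x, A x -> ~ B x].

Lemma closed_pair0 : closed_pair set0 set0.
Proof. by split; [exact: closed0|exact: closed0|]. Qed.

Lemma compactT A : closed A -> compact A.
Proof. by move=> cA; exact: sub_compact cT cA _. Qed.

Lemma closed_pair_dist A B : closed_pair A B ->
  exists2 r, 0 < r & forall x y, A x -> B y -> r <= mdist x y.
Proof.
move=> [cA cB AB].
have [|r r0 rB] := compact_sub_nbd (compactT cA) (closed_openC cB) _.
  by move=> x /AB.
exists r => // x y Ax By; rewrite leNgt; apply/negP => xy.
by apply: (rB y) => //; exists x.
Qed.

Definition fin_ball (r : R) (s : seq T) : set T :=
  [set x | exists2 p, p \in s & mdist p x <= r].

Lemma closed_fin_ball r s : closed (fin_ball r s).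
Proof.
apply/closed_metricP => x nx.
have [e e0 eP] : exists2 e, 0 < e & forall p, p \in s -> r + e <= mdist p x.
  elim: s nx => [_|p s IH nx]; first by exists 1.
  have [|e e0 eP] := IH.
    by move=> [q qs qx]; apply: nx; exists q; rewrite // inE qs orbT.
  have px : r < mdist p x.
    by rewrite ltNge; apply/negP => px; apply: nx; exists p; rewrite // inE eqxx.
  exists (Num.min e (mdist p x - r)); first by rewrite lt_min e0 subr_gt0.
  move=> q; rewrite inE => /orP[/eqP ->|/eqP].
    by rewrite -lerBrDl ge_min lexx orbT.
  by move=> /eqP/eP; apply: le_trans; rewrite lerD2l ge_min lexx.
exists e => // y xy [p ps py]; have := eP p ps.
by have := metric_triangle p y x; rewrite (metric_sym y x); lra.
Qed.

Lemma finite_net (r : R) : 0 < r ->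
  exists s : seq T, forall x, exists2 p, p \in s & mdist p x < r.
Proof.
move=> r0.
suff [s sP] : exists s : seq T, forall x, [set: T] x -> exists2 p, p \in s & mdist p x < r.
  by exists s => x; exact: sP.
apply: (compact_local_ind (Q := fun A => exists s : seq T,
  forall x, A x -> exists2 p, p \in s & mdist p x < r)) cT _ _ _ _.
- by exists [::].
- by move=> A B AB [s sP]; exists s => x /AB/sP.
- move=> A B [s sP] [s' s'P]; exists (s ++ s') => x [/sP|/s'P] [p ps px];
    by exists p; rewrite // mem_cat ps ?orbT.
- move=> x _; exists (ball x r); first exact: nbhsx_ballx.
  by exists [:: x] => y [_]; rewrite ballEmdist => xy; exists x; rewrite // inE.
Qed.

(* Countably many closed pairs, indexed by the scale of a finite net and the
   nodes of the net used for each set, suffice to test partitions. *)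
Lemma closed_pair_family n : exists (m : nat -> nat) (A B : nat -> nat -> set T),
  (forall j i, closed_pair (A j i) (B j i)) /\
  forall (A' B' : nat -> set T) M,
    (forall i, (i < n)%N -> closed_pair (A' i) (B' i)) ->
    exists2 j, (M <= m j)%N &
      forall i, (i < n)%N -> A' i `<=` A j i /\ B' i `<=` B j i.
Proof.
have /choice[s sP] (k : nat) : exists s : seq T,
    forall x, exists2 p, p \in s & mdist p x < k.+1%:R^-1.
  by apply: finite_net; rewrite invr_gt0.
pose code := (nat * seq (bitseq * bitseq))%type.
pose dec j : code := odflt (0%N, [::]) (unpickle j).
pose A (c : code) i := fin_ball (c.1.+1%:R^-1) (mask (nth ([::], [::]) c.2 i).1 (s c.1)).
pose B (c : code) i := fin_ball (c.1.+1%:R^-1) (mask (nth ([::], [::]) c.2 i).2 (s c.1)).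
pose ok c i := forall x, A c i x -> ~ B c i x.
(* Where the two coded sets meet, the empty pair replaces them, so every member is a closed pair. *)
exists (fun j => (dec j).1), (fun j i => if `[< ok (dec j) i >] then A (dec j) i else set0),
  (fun j i => if `[< ok (dec j) i >] then B (dec j) i else set0); split.
  move=> j i; case: asboolP => [okji|_]; last exact: closed_pair0.
  by split=> //; exact: closed_fin_ball.
move=> A' B' M cAB.
(* Points of the net balls covering a set are less than two scales from it, so a gap of four scales
   keeps two such coverings disjoint. *)
have [k Mk kP] : exists2 k, (M <= k)%N & forall i x y, (i < n)%N -> A' i x -> B' i y ->
    4 * k.+1%:R^-1 <= mdist x y.
  elim: n cAB => [_|n IH cAB]; first by exists M.
  have [i lt_in|k Mk kP] := IH; first by apply: cAB; rewrite ltnS ltnW.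
  have [r r0 rP] := closed_pair_dist (cAB n (ltnSn n)).
  pose l := Num.truncn (4 / r).
  have lP : 4 * l.+1%:R^-1 <= r.
    rewrite ler_pdivrMr ?ltr0n// mulrC -ler_pdivrMr//; apply: ltW; exact: truncnS_gt.
  exists (maxn k l) => [|i x y]; first by rewrite leq_max Mk.
  rewrite ltnS leq_eqVlt => /orP[/eqP ->|lt_in] Ax By.
    apply: le_trans (rP _ _ Ax By); apply: le_trans lP.
    by rewrite ler_pM2l// lef_pV2 ?posrE ?ltr0n// ler_nat ltnS leq_maxr.
  apply: le_trans (kP i _ _ lt_in Ax By).
  by rewrite ler_pM2l// lef_pV2 ?posrE ?ltr0n// ler_nat ltnS leq_maxl.
pose near (D : set T) p := `[< exists2 x, D x & mdist p x < k.+1%:R^-1 >].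
pose c : code := (k, mkseq (fun i => (map (near (A' i)) (s k), map (near (B' i)) (s k))) n).
have cA i : (i < n)%N -> A c i = fin_ball k.+1%:R^-1 [seq p <- s k | near (A' i) p].
  by move=> lt_in; rewrite /A /= nth_mkseq//= filter_mask.
have cB i : (i < n)%N -> B c i = fin_ball k.+1%:R^-1 [seq p <- s k | near (B' i) p].
  by move=> lt_in; rewrite /B /= nth_mkseq//= filter_mask.
have sub (D : set T) : D `<=` fin_ball k.+1%:R^-1 [seq p <- s k | near D p].
  move=> x Dx; have [p ps px] := sP k x; exists p; last exact: ltW.
  by rewrite mem_filter ps andbT; apply/asboolP; exists x.
have okc i : (i < n)%N -> ok c i.
  move=> lt_in x; rewrite cA// cB// => -[p + px] [q + qx].
  rewrite !mem_filter => /andP[/asboolP[a Aa pa] _] /andP[/asboolP[b Bb qb] _].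
  have := kP i a b lt_in Aa Bb.
  have := metric_triangle a p b; have := metric_triangle p x b; have := metric_triangle x q b.
  rewrite (metric_sym a p) (metric_sym x q); move: pa px qx qb.
  by move: (k.+1%:R^-1 : R) => r; lra.
exists (pickle c); rewrite /dec pickleK //= => i lt_in.
by case: asboolP => [_|/(_ (okc i lt_in))//]; rewrite cA// cB//; split; exact: sub.
Qed.

End partitions.

(** * Thin partitions and upper bounds for the dimension *)

Section thin_partitions.
Context {R : realType} {T : metricType R} (t : R) (t0 : 0 < t).
Context (cT : compact [set: T]).
Implicit Types A B C D U W : set T.

(** The partition proper is what [U] and [W] leave uncovered in [C]. Disjointness is asked of the
    closures so that they can be the next closed pair of an iteration. *)
Definition partition_in C A B U W : Prop :=
  [/\ open U, open W, forall x, closure U x -> ~ closure W x,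
      C `&` A `<=` U & C `&` B `<=` W].

(** For [n = 0] the union is empty, so [C] itself has arbitrarily small content. *)
Definition thin_partitions n C : Prop := forall e, 0 < e ->
  forall A B : nat -> set T, (forall i, (i < n)%N -> closed_pair (A i) (B i)) ->
  exists U W : nat -> set T,
    (forall i, (i < n)%N -> partition_in C (A i) (B i) (U i) (W i)) /\
    small t e (C `\` \bigcup_(i in [set i | (i < n)%N]) (U i `|` W i)).

Lemma partition_in_sub C D A B U W : C `<=` D -> partition_in D A B U W ->
  partition_in C A B U W.
Proof.
by move=> CD [oU oW UW AU BW]; split => // x [Cx ?]; [apply: AU|apply: BW];
  split => //; exact: CD.
Qed.

Lemma thin_partitions_sub n C D : C `<=` D -> thin_partitions n D -> thin_partitions n C.
Proof.
move=> CD DP e e0 A B AB; have [U [W [UW sUW]]] := DP e e0 A B AB.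
exists U, W; split=> [i lt_in|]; first exact: partition_in_sub (UW i lt_in).
by apply: small_sub sUW => x [/CD].
Qed.

(* Separators are built as decreasing intersections: stage [k] thickens both
   sides so as to leave room for the [k]-th test pairs only. *)
Lemma thin_partitions_split n C A0 B0 : thin_partitions n.+1 C -> closed_pair A0 B0 ->
  exists U W, [/\ open U /\ open W, C `&` A0 `<=` U, C `&` B0 `<=` W,
    forall x, C x -> U x -> ~ W x & thin_partitions n (C `\` (U `|` W))].
Proof.
move=> CP cAB0.
have [m [A [B [cAB ABP]]]] := closed_pair_family cT n.
(* What [q] leaves uncovered in [C] admits separators of the [k]-th test tuple with a common part of
   content [1 / (m k).+1]. *)
pose stage k (p q : set T * set T) := partition_in C p.1 p.2 q.1 q.2 /\
  exists U W : nat -> set T,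
    (forall i, (i < n)%N -> partition_in C (A k i) (B k i) (U i) (W i)) /\
    small t (m k).+1%:R^-1
      ((C `\` (q.1 `|` q.2)) `\` \bigcup_(i in [set i | (i < n)%N]) (U i `|` W i)).
have /choice[f fP] (kp : nat * (set T * set T)) : exists q,
    closed_pair kp.2.1 kp.2.2 -> stage kp.1 kp.2 q.
  case: kp => k p /=; have [cp|ncp] := pselect (closed_pair p.1 p.2); last by exists p.
  have e0 : 0 < (m k).+1%:R^-1 :> R by rewrite invr_gt0.
  have [[|i] lt_in //|U [W [UW sUW]]] := CP _ e0
    (fun i => if i is i'.+1 then A k i' else p.1)
    (fun i => if i is i'.+1 then B k i' else p.2).
  exists (U 0%N, W 0%N) => _; split; first exact: (UW 0%N).
  exists (fun i => U i.+1), (fun i => W i.+1); split=> [i lt_in|]; first exact: (UW i.+1).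
  apply: small_sub sUW => x [[Cx nx0] nx]; split=> // -[[|i] /= lt_in UWx]; first exact: nx0.
  by apply: nx; exists i.
pose F := fix F k := if k is k'.+1 then
  let q := f (k', F k') in (closure q.1, closure q.2) else (A0, B0).
have cF k : closed_pair (F k).1 (F k).2.
  elim: k => [//|k IH]; have [[_ _ UW _ _] _] := fP (k, F k) IH.
  by split => //=; exact: closed_closure.
pose U k := (f (k, F k)).1; pose W k := (f (k, F k)).2.
have st k : stage k (F k) (U k, W k) by have := fP (k, F k) (cF k); rewrite /U /W; case: (f _).
have Umono k l x : (k <= l)%N -> C x -> U k x -> U l x.
  move=> /subnK <- Cx Ux; elim: (l - k)%N => [//|j IH].
  have [[_ _ _ AU _] _] := st (j + k).+1; apply: AU; split=> //=; exact: subset_closure.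
have Wmono k l x : (k <= l)%N -> C x -> W k x -> W l x.
  move=> /subnK <- Cx Wx; elim: (l - k)%N => [//|j IH].
  have [[_ _ _ _ BW] _] := st (j + k).+1; apply: BW; split=> //=; exact: subset_closure.
exists (\bigcup_k U k), (\bigcup_k W k); split.
- by split; apply: bigcup_open => k _; have [[]] := st k.
- by move=> x CAx; exists 0%N => //; have [[_ _ _ AU _] _] := st 0%N; exact: AU.
- by move=> x CBx; exists 0%N => //; have [[_ _ _ _ BW] _] := st 0%N; exact: BW.
- move=> x Cx [k _ Ux] [l _ Wx]; have [[_ _ UW _ _] _] := st (maxn k l).
  by apply: (UW x); apply: subset_closure;
    [exact: Umono (leq_maxl _ _) Cx Ux|exact: Wmono (leq_maxr _ _) Cx Wx].
move=> e e0 A' B' cAB'.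
(* The chosen test pairs contain the given ones, and [m k] is at least the integer part of [1 / e],
   so [1 / (m k).+1 <= e]. The final partition is contained in that of stage [k]. *)
have [k Mk kP] := ABP A' B' (Num.truncn e^-1) cAB'.
have [_ [U' [W' [UW' sUW']]]] := st k.
exists U', W'; split=> [i lt_in|].
  have [AA BB] := kP i lt_in; have [oU oW cUW AU BW] := UW' i lt_in.
  by split => // x [[Cx _] ?]; [apply: AU|apply: BW]; split=> //; [exact: AA|exact: BB].
apply: (@small_le _ _ _ (m k).+1%:R^-1).
  rewrite -(invrK e) lef_pV2 ?posrE ?invr_gt0//.
  apply: ltW; apply: lt_le_trans (truncnS_gt _) _; by rewrite ler_nat ltnS.
apply: small_sub sUW' => x [[Cx nx] nx']; split=> //; split=> // -[Ux|Wx]; apply: nx.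
  by left; exists k.
by right; exists k.
Qed.

(** Separating [x] from the points at distance at least [a] gives a small neighbourhood of [x] whose
    boundary lies in the partition. The bound one level lower is a hypothesis, so that the global
    and local statements share this step. *)
Lemma dim_tH_step n C (s : R) : closed C ->
  (forall x, C x -> exists2 r, 0 < r &
    thin_partitions n.+1 (C `&` [set y | mdist x y <= r])) ->
  (forall B, closed B -> thin_partitions n B -> (dim_tH n B <= s%:E)%E) ->
  0 <= s ->
  (dim_tH n.+1 C <= (s + 1)%:E)%E.
Proof.
move=> cC Cloc IH s0 /=; case: ifP => [_|_].
  by rewrite lee_fin; lra.
apply: ereal_inf_lbound => /=; apply: basis_boundary_intro => // x d Cx d0.
have [r r0 Cr] := Cloc x Cx.
pose a := Num.min d (r / 2).
have a0 : 0 < a by rewrite lt_min d0 divr_gt0.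
have ad : a <= d by rewrite ge_min lexx.
have ar : a <= r / 2 by rewrite ge_min lexx orbT.
have clx : closed_pair [set x] [set y | a <= mdist x y].
  split.
  - by apply: compact_closedT; exact: compact_set1.
  - apply/closed_metricP => y /negP; rewrite -ltNge => xy.
    exists (a - mdist x y); first by rewrite subr_gt0.
    move=> z yz /=; have := metric_triangle x y z; lra.
  - by move=> _ -> /=; rewrite mdistxx leNgt a0.
have [U [W [[oU oW] AU BW UW nUW]]] := thin_partitions_split Cr clx.
have Cball y : C y -> mdist x y < r -> (C `&` [set y | mdist x y <= r]) y.
  by move=> Cy xy; split => //=; exact: ltW.
have oball b : open [set y | mdist x y < b].
  apply/open_metricP => y xy; exists (b - mdist x y); first by rewrite subr_gt0.
  by move=> z yz /=; have := metric_triangle x y z; move: xy => /=; lra.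
have ofar : open [set y | a < mdist x y].
  apply/open_metricP => y xy; exists (mdist x y - a); first by rewrite subr_gt0.
  by move=> z yz /=; have := metric_triangle x z y;
    rewrite (metric_sym z y); move: xy => /=; lra.
exists (U `&` [set y | mdist x y < a]),
  ((W `&` [set y | mdist x y < r]) `|` [set y | a < mdist x y]).
split.
- split; first exact: openI.
  by apply: openU => //; exact: openI.
- split; last by rewrite /= mdistxx.
  by apply: AU; split => //; apply: Cball => //; rewrite mdistxx.
- move=> y Cy [Uy /= ya] [[Wy /= yr]|/= ay]; last lra.
  exact: (UW y (Cball y Cy yr)).
- move=> y Cy dxy; have [axy|axy] := ltP a (mdist x y); first by right.
  left; split; last by rewrite /=; lra.
  apply: BW; split=> /=; last exact: le_trans ad dxy.
  by apply: Cball => //; lra.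
move=> B cB BC; rewrite (_ : (s + 1)%:E - 1 = s%:E)%E; last by rewrite -EFinB addrK.
apply: IH => //; apply: thin_partitions_sub nUW => y /BC[Cy /not_orP[nU /not_orP[nW /= nay]]].
have ya : mdist x y <= a by rewrite leNgt; apply/negP.
have Cy' : (C `&` [set y | mdist x y <= r]) y by apply: Cball => //; lra.
(* A point of [B] in [U] would be at distance exactly [a] from [x], but such points of [C] were put
   in [W]. *)
split => // -[Uy|Wy].
  have ya' : mdist x y = a.
    by apply/eqP; rewrite eq_le ya leNgt; apply/negP => yxa; apply: nU.
  apply: (UW y Cy' Uy); apply: BW; split => //=; by rewrite ya'.
by apply: nW; split => //=; lra.
Qed.

Lemma dim_tH_le n C : closed C -> thin_partitions n C -> (dim_tH n C <= (t + n%:R)%:E)%E.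
Proof.
elim: n C => [|n IH] C cC CP.
  rewrite addr0; apply: dimH_le_small => // e e0.
  have [//|U [W [_ sC]]] := CP e e0 (fun=> set0) (fun=> set0).
  by apply: small_sub sC => x Cx; split=> // -[].
rewrite -natr1 addrA; apply: dim_tH_step => //.
- move=> x Cx; exists 1 => //; apply: thin_partitions_sub CP; exact: subIsetl.
- by rewrite addr_ge0 ?ler0n// ltW.
Qed.

(** The local hypothesis is spent in the first step: the boundaries it produces lie in a small ball
    and have thin partitions globally. *)
Lemma dim_tH_le_local n C : closed C ->
  (forall x, C x -> exists2 r, 0 < r &
    thin_partitions n.+1 (C `&` [set y | mdist x y <= r])) ->
  (dim_tH n.+1 C <= (t + n.+1%:R)%:E)%E.
Proof.
move=> cC Cloc; rewrite -natr1 addrA; apply: dim_tH_step => //; first exact: dim_tH_le.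
by rewrite addr_ge0 ?ler0n// ltW.
Qed.

End thin_partitions.

(** * From dense sets of functions to dimension *)

Section lower_bound.
Context {R : realType} {T : metricType R}.
Context (cT : compact [set: T]).

Lemma open_lt_cont (g : T -> R) (c : R) : continuous g -> open [set x | g x < c].
Proof.
move=> /continuous_metricP cg; apply/open_metricP => x gx.
have [|r r0 rP] := cg x (c - g x); first by rewrite subr_gt0.
exists r => // y /rP; rewrite ltr_norml => /andP[H _] /=; lra.
Qed.

Lemma closure_lt_cont (g : T -> R) (c : R) : continuous g ->
  closure [set x | g x < c] `<=` [set x | g x <= c].
Proof.
move=> /continuous_metricP cg x /closure_metricP clx /=; rewrite leNgt; apply/negP => gx.
have [|r r0 rP] := cg x (g x - c); first by rewrite subr_gt0.
have [y /= gy /rP] := clx r r0; rewrite ltr_norml => /andP[_]; lra.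
Qed.

Lemma closed_fiber n (f : T -> 'rV[R]_n) y : continuous f -> closed (f @^-1` [set y]).
Proof.
move=> cf; apply: preimage_closed => //.
by apply: compact_closed; [exact: norm_hausdorff|exact: compact_set1].
Qed.

Lemma fiber_nbd n (f : T -> 'rV[R]_n) y (V : set T) : continuous f -> open V ->
  f @^-1` [set y] `<=` V -> exists2 eta, 0 < eta & [set x | `|f x - y| < eta] `<=` V.
Proof.
move=> /continuous_metricP cf oV fV.
have cV : compact (~` V) by apply: compactT => //; exact: open_closedC.
have [|eta eta0 etaP] := @compact_uniform _ _ _ (fun r x => r <= `|f x - y|) cV.
  move=> x nVx; have c0 : 0 < `|f x - y|.
    by rewrite normr_gt0 subr_eq0; apply/eqP => fxy; apply: nVx; exact: fV.
  have [|r r0 rP] := cf x (`|f x - y| / 2); first lra.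
  exists (Num.min r (`|f x - y| / 2)); first by rewrite lt_min r0 divr_gt0.
  move=> z r'; rewrite !lt_min => /andP[/rP fxz _] r'0 /andP[_ r'c].
  have := ler_normD (f x - f z) (f z - y); rewrite addrA subrK; lra.
exists eta => // x /= fx; apply: contrapT => /etaP; lra.
Qed.

(** Adding [e / 2] times Urysohn functions to the coordinates of [f0] pushes [A j] and [B j], near
    [x0], to opposite sides of [y0 = f0 x0]. A nearby [h] with fibers of dimension at most [s] keeps
    them there, and the common part of the partitions lies in a small neighbourhood of its fiber
    over [y0]. *)
Lemma thin_partitions_of_dense n (s t : R) (f0 : continuousType T 'rV[R]_n.+1) (e : R) :
  0 < t -> s < t -> 0 < e ->
  (forall g : continuousType T 'rV[R]_n.+1, (forall x, `|f0 x - g x| < e) ->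
    forall eta, 0 < eta -> exists2 h : continuousType T 'rV[R]_n.+1,
      (forall x, `|g x - h x| < eta) & forall y, (dimH (h @^-1` [set y]) <= s%:E)%E) ->
  forall x0 : T, exists2 r, 0 < r & thin_partitions t n.+1 [set y : T | mdist x0 y <= r].
Proof.
move=> t0 st e0 Hdense x0.
have cf0 : continuous f0 := @cts_fun _ _ f0.
have e40 : 0 < e / 4 by lra.
have /continuous_metricP/(_ x0 _ e40)[r r0 rP] := cf0.
exists (r / 2); first lra.
move=> a a0 A B AB; set y0 := f0 x0 in rP.
have normalT : normal_space T := compact_normal (@metric_hausdorff _ T) cT.
have /choice[u uP] (j : 'I_n.+1) : exists u : T -> R, [/\ continuous u,
    forall x, A j x -> u x = -1, forall x, B j x -> u x = 1 & forall x, `|u x| <= 1].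
  have [cA cB ABj] := AB j (ltn_ord j).
  have AB0 : A j `&` B j = set0 by rewrite -subset0 => x [/ABj].
  have N11 : -1 < 1 :> R by lra.
  have [u [cu uA uB u1]] := urysohn_ext_itv normalT cA cB AB0 N11.
  exists u; split=> // x.
  - by move=> Ax; apply: uA; exists x.
  - by move=> Bx; apply: uB; exists x.
  - by have /= := u1 (u x) (ex_intro2 _ _ x I erefl); rewrite in_itv /= ler_norml.
have cf : continuous (fun x => \row_j (f0 x 0 j + e / 2 * u j x) : 'rV[R]_n.+1).
  apply: continuous_row => j x; apply: cvgD; first exact: (@continuous_coord _ _ _ _ j cf0).
  by apply: cvgMr; have [cu _ _ _] := uP j; exact: cu.
have e80 : 0 < e / 8 by lra.
have [x|h hf hs] := Hdense (mkcts cf) _ _ e80.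
  apply/rV_norm_ltP => // j; rewrite !mxE opprD addrA subrr sub0r normrN normrM.
  rewrite gtr0_norm; last lra.
  have [_ _ _ u1] := uP j; have := u1 x; nra.
have ch : continuous h := @cts_fun _ _ h.
have chj j : continuous (fun x => h x 0 j) by exact: (@continuous_coord _ _ _ _ j ch).
have [V [oV fV sV]] : exists V, [/\ open V, h @^-1` [set y0] `<=` V & small t a V].
  apply: small_open; apply: small_of_dimH => //.
    by apply: compactT => //; exact: closed_fiber.
  by apply: le_lt_trans (hs y0) _; rewrite lte_fin.
have [eta eta0 etaV] := fiber_nbd ch oV fV.
(* On [A j] near [x0], coordinate [j] of [h] is below that of [y0] by more than
   [e / 2 - e / 4 - e / 8 = e / 8], and symmetrically on [B j]; [b] is below this margin, and below
   [eta] so that the remainder falls in [V]. *)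
pose b := Num.min (eta / 2) (e / 16).
have b0 : 0 < b by rewrite lt_min !divr_gt0.
have beta : b <= eta / 2 by rewrite ge_min lexx.
have be : b <= e / 16 by rewrite ge_min lexx orbT.
exists (fun i => [set x | h x 0 (inord i) < y0 0 (inord i) - b]),
  (fun i => [set x | - h x 0 (inord i) < - y0 0 (inord i) - b]); split.
  move=> i lt_in; set j : 'I_n.+1 := inord i.
  have ji : j = i :> nat by rewrite inordK.
  have coordP x : mdist x0 x <= r / 2 -> `|y0 0 j - f0 x 0 j| < e / 4 /\
      `|f0 x 0 j + e / 2 * u j x - h x 0 j| < e / 8.
    move=> x0x; split.
      have /rP/(rV_norm_ltP _ e40)/(_ j) : mdist x0 x < r by lra.
      by rewrite !mxE.
    by have /(rV_norm_ltP _ e80)/(_ j) := hf x; rewrite !mxE.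
  have chNj : continuous (fun x => - h x 0 j) by move=> x; apply: cvgN; exact: chj.
  have [_ uA uB _] := uP j; rewrite ji in uA uB.
  split.
  - exact: open_lt_cont.
  - exact: open_lt_cont.
  - move=> x /(closure_lt_cont (chj j)) /= hx /(closure_lt_cont chNj) /=; lra.
  - move=> x [/= /coordP[+ +] Ax]; rewrite (uA x Ax) !ltr_norml.
    by move=> /andP[? ?] /andP[? ?]; lra.
  - move=> x [/= /coordP[+ +] Bx]; rewrite (uB x Bx) !ltr_norml.
    by move=> /andP[? ?] /andP[? ?]; lra.
apply: small_sub sV => x [_ nx]; apply: etaV => /=; apply/rV_norm_ltP => // j.
rewrite !mxE; apply: (@le_lt_trans _ _ b); last lra.
rewrite leNgt; apply/negP => bj; apply: nx; exists j; first exact: ltn_ord.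
rewrite /= inord_val; move: bj; rewrite lter_normr => /orP[bj|bj]; [right|left] => /=; lra.
Qed.

Lemma dimH_ge0 (A : set T) : A !=set0 -> (0 <= dimH A)%E.
Proof.
move=> /set0P/negbTE A0; rewrite /dimH A0.
by apply: le_ereal_inf_tmp => _ [s [s0 _] <-]; rewrite lee_fin.
Qed.

(** Both notions recurse through boundaries alike; at the bottom, negative Hausdorff dimension means
    emptiness. *)
Lemma dim_t_lt_dim_tH n (A : set T) : (dim_tH n A < n%:R%:E)%E -> dim_t_lt n A.
Proof.
elim: n A => [|n IH] A /=.
  move=> A0; apply: contrapT => /eqP/set0P/dimH_ge0.
  by rewrite leNgt A0.
case: ifP => [/eqP -> _|_ /inductive_step_lt]; first exact: set0_basis_with_boundaries.
by apply: basis_with_boundaries_sub => V; rewrite -natr1 addrK; exact: IH.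
Qed.

End lower_bound.

(** * Nowhere dense classes of functions and the generic supremum *)

Section generic_fibers.
Context {R : realType} {K : metricType R} (n : nat).
Context (cK : compact [set: K]).
Local Notation C := (continuousType K 'rV[R]_n.+1).

Lemma nowhere_dense_not_thin t e : 0 < t -> 0 < e ->
  (dim_tH n.+1 [set: K] < (t + n.+1%:R)%:E)%E ->
  nowhere_dense [set f : C | ~ thin t e f].
Proof.
move=> t0 e0 Dt; apply: nowhere_dense_continuousType => f eps eps0.
have cov := coverable_dim_tH t0 cK Dt.
have [g [fg [eta eta0 gthin]]] := thin_dense t0 cK cov f e0 eps0.
exists g => //; exists (eta / 2); first by rewrite divr_gt0.
by move=> h gh; apply; exact: thin_near gthin eta0 gh.
Qed.

(** Otherwise such functions would be dense in a ball, every point of [K] would have a neighbourhood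
    with thin partitions, and [dim_tH] would be at most [t + n.+1]. *)
Lemma nowhere_dense_small_fibers s : 0 <= s ->
  (s%:E < dim_tH n.+1 [set: K] - n.+1%:R%:E)%E ->
  nowhere_dense [set f : C | forall y, (dimH (f @^-1` [set y]) <= s%:E)%E].
Proof.
move=> s0 sD.
(* Strictness [s < t] gives fibers of dimension at most [s] arbitrarily small [t]-content; for
   infinite dimension [s + 1] serves. *)
have [t st tD] : exists2 t, s < t & ((t + n.+1%:R)%:E < dim_tH n.+1 [set: K])%E.
  move: sD; case: (dim_tH n.+1 [set: K]) => [d| _|//].
    rewrite -EFinB lte_fin => sd; exists ((s + (d - n.+1%:R)) / 2); first lra.
    rewrite lte_fin; lra.
  by exists (s + 1); [lra|rewrite ltry].
apply: nowhere_dense_continuousType => f e e0; apply: contrapT => nex.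
suff : (dim_tH n.+1 [set: K] <= (t + n.+1%:R)%:E)%E by rewrite leNgt tD.
have t0 : 0 < t by exact: le_lt_trans st.
apply: dim_tH_le_local => // x _.
have [g fg eta eta0|r r0 rP] := @thin_partitions_of_dense _ _ cK n s t f e t0 st e0 _ x.
- apply: contrapT => nh; apply: nex; exists g => //; exists eta => // h gh hS.
  by apply: nh; exists h.
by exists r => //; apply: thin_partitions_sub rP => y [].
Qed.

End generic_fibers.

Local Open Scope ereal_scope.

Theorem corollary6p13 (R : realType) (n : nat) (K : metricType R) :
  (0 < n)%N ->
  compact [set: K] ->
  n%:R%:E <= dim_t [set: K] ->
  comeager [set f : continuousType K 'rV[R]_n |
    ereal_sup (range (fun y : 'rV[R]_n => dimH (f @^-1` [set y]))) =
    dim_tH n [set: K] - n%:R%:E].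
Proof.
case: n => [//|n] _ cK ndimK.
set D := dim_tH n.+1 [set: K].
have ndim_lt : ~ dim_t_lt n.+1 [set: K].
  by move=> /dim_t_le/(le_trans ndimK); rewrite lee_fin lerBrDl gerDr ler10.
have nD : n.+1%:R%:E <= D by rewrite leNgt; apply/negP => /dim_t_lt_dim_tH.
have [x0 _] : [set: K] !=set0.
  by apply/set0P/negP => /eqP K0; apply: ndim_lt; exact: (@dim_t_lt_le _ _ 0 _ _ _ K0).
(* Exponents decreasing to [D - n.+1]. As [fine] returns 0 at infinity, the sets built from them
   carry the guard [D < +oo]. *)
pose t k := (fine D - n.+1%:R + k.+1%:R^-1)%R.
(* The left sets catch the functions with supremum above [D - n.+1], the right ones those with
   supremum below it; rational bounds keep the family countable. *)
pose F (i : (nat * nat) + rat) := match i with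
  | inl (k, m) => [set f : continuousType K 'rV[R]_n.+1 |
      D < +oo /\ ~ thin (t k) m.+1%:R^-1 f]
  | inr q => [set f | [/\ 0 <= (ratr q : R)%:E, (ratr q)%:E < D - n.+1%:R%:E &
      forall y, dimH (f @^-1` [set y]) <= (ratr q)%:E]]
  end.
apply: (@meager_cover _ _ F).
  move=> [[k m]|q] /=.
    have [Dfin|nDfin] := pselect (D < +oo); last first.
      by apply: nowhere_dense_continuousType => f e e0; exists f => [x|];
        [rewrite subrr normr0|exists 1%R => // h _ []].
    have -> : [set f : continuousType K 'rV[R]_n.+1 |
        D < +oo /\ ~ thin (t k) m.+1%:R^-1 f] = [set f | ~ thin (t k) m.+1%:R^-1 f].
      by apply/seteqP; split=> f /=; [case|].
    have k0 : (0 < k.+1%:R^-1 :> R)%R by rewrite invr_gt0.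
    move: nD Dfin; rewrite /t -/D; case DE : D => [d| |] //= nd _.
    rewrite lee_fin in nd; move: (k.+1%:R^-1)%R k0 => a a0.
    apply: nowhere_dense_not_thin; rewrite ?invr_gt0// -/D; first lra.
    by rewrite DE lte_fin; lra.
  have [q0|q0] := leP 0 (ratr q : R)%:E; last first.
    by apply: nowhere_dense_continuousType => f e e0; exists f => [x|];
      [rewrite subrr normr0|exists 1%R => // h _ []].
  have [qD|qD] := ltP (ratr q : R)%:E (D - n.+1%:R%:E); last first.
    by apply: nowhere_dense_continuousType => f e e0; exists f => [x|];
      [rewrite subrr normr0|exists 1%R => // h _ []].
  rewrite [X in nowhere_dense X](_ : _ = [set f : continuousType K 'rV[R]_n.+1 |
      forall y, dimH (f @^-1` [set y]) <= (ratr q)%:E]).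
    by apply: nowhere_dense_small_fibers => //; rewrite -lee_fin.
  by apply/seteqP; split=> f /=; [case|].
move=> f /= nf; set S := ereal_sup _ in nf.
have S0 : 0 <= S.
  apply: le_trans (dimH_ge0 (_ : (f @^-1` [set f x0]) !=set0)) _; first by exists x0.
  by apply: ereal_sup_ubound; exists (f x0).
have SP y : dimH (f @^-1` [set y]) <= S by apply: ereal_sup_ubound; exists y.
have [SD|DS|//] := ltgtP S (D - n.+1%:R%:E).
  have [q [Sq qD]] : exists q : rat, S <= (ratr q)%:E /\ (ratr q)%:E < D - n.+1%:R%:E.
    case: S S0 SD {SP nf} => [r _ rD|_|//]; last by rewrite ltNge leey.
    have [r' rr' r'D] : exists2 r', (r < r')%R & r'%:E <= D - n.+1%:R%:E.
      move: rD; case: (D - _) => [d|_|//]; last by exists (r + 1)%R; [lra|rewrite leey].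
      by rewrite lte_fin => rd; exists d.
    have [q] := rat_in_itvoo rr'; rewrite in_itv /= => /andP[rq qr'].
    exists q; rewrite lee_fin ltW//; split=> //.
    by apply: lt_le_trans r'D; rewrite lte_fin.
  exists (inr q) => //; split=> //; first exact: le_trans Sq.
  by move=> y; exact: le_trans Sq.
(* A single fiber has dimension above [D - n.+1], hence above some [t k]; a function thin at all
   levels for the exponent [t k] has no such fiber. *)
have [_ [y _ <-] Dy] := ereal_sup_gt DS.
have Dfin : D < +oo.
  by rewrite ltNge leye_eq; apply/negP => /eqP DE; move: DS; rewrite DE /= ltNge leey.
have DE : D = (fine D)%:E.
  by rewrite fineK// fin_numE (lt_eqF Dfin) andbT gt_eqF// (lt_le_trans _ nD)// ltNyr.
have [k tk] : exists k, (t k)%:E < dimH (f @^-1` [set y]).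
  move: Dy; rewrite DE -EFinB; case: (dimH _) => [r|_|//]; last first.
    by exists 0%N; rewrite ltry.
  rewrite lte_fin => Dr; set a := (r - (fine D - n.+1%:R))%R.
  have a0 : (0 < a)%R by rewrite /a; lra.
  exists (Num.truncn a^-1); rewrite lte_fin /t.
  have : ((Num.truncn a^-1).+1%:R^-1 < a)%R.
    rewrite -[X in (_ < X)%R]invrK ltf_pV2 ?posrE ?invr_gt0//; exact: truncnS_gt.
  by move: (_^-1)%R => b; rewrite /a; lra.
have tk0 : (0 < t k)%R.
  have k0 : (0 < k.+1%:R^-1 :> R)%R by rewrite invr_gt0.
  by move: nD; rewrite DE lee_fin /t; move: (k.+1%:R^-1)%R k0 => a a0; lra.
apply: contrapT => nF.
have thinf m : thin (t k) m.+1%:R^-1 f.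
  by apply: contrapT => nth; apply: nF; exists (inl (k, m)).
have : dimH (f @^-1` [set y]) <= (t k)%:E; last by rewrite leNgt tk.
apply: dimH_le_small => // e e0.
have [eta eta0 /(_ y) sy] := thinf (Num.truncn e^-1).
apply: (@small_le _ _ _ (Num.truncn e^-1).+1%:R^-1%R).
  rewrite -[X in (_ <= X)%R]invrK lef_pV2 ?posrE ?invr_gt0//.
  by apply: ltW; exact: truncnS_gt.
by apply: small_sub sy => x /= ->; rewrite subrr normr0.
Qed.
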